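(* In the setting of the context, for $h=1/n$ small enough ($n$ a positive integer) the explicit Euler algorithm described in the context is well-defined, i.e. $(p_k,kh)\in\mathcal{O}$ at each step so that $p_k$ is defined for every $k=0,\dots,n$, and the uniform error between the piecewise constant function $p^h$ and the optimal price $p$ is $O(h)$: there exist $h_0>0$ and a constant $K$ such that $\sup_{\varepsilon\in[0,1]}|p^h(\varepsilon)-p(\varepsilon)|\le K h$ for all $h=1/n\le h_0$.
   Context: Setting: $\Omega\subset\mathbb{R}^2$ is a (bounded) convex polygon with area $|\Omega|=1$, and $y_1,\dots,y_N\in\Omega$ are points whose second coordinates $y_i^{(2)}$ are pairwise different. For $\varepsilon\in[0,1]$, $A_\varepsilon=\mathrm{diag}(\varepsilon,1)$ and $c_\varepsilon(x,y)=\langle A_\varepsilon(x-y),x-y\rangle=\varepsilon(x^{(1)}-y^{(1)})^2+(x^{(2)}-y^{(2)})^2$. For $p\in\mathbb{R}^N$, define $$\Phi(p,\varepsilon)=\frac1N\sum_{i=1}^N p_i+\int_\Omega\min_i\{c_\varepsilon(x,y_i)-p_i\}\,dx$$ and the cells $$C(p,\varepsilon)_i=\Big\{x\in\Omega:\ \min_j\,(c_\varepsilon(x,y_j)-p_j)=c_\varepsilon(x,y_i)-p_i\Big\},\qquad i=1,\dots,N.$$ For each $\varepsilon$, with the normalization $p_1=0$, $\Phi(\cdot,\varepsilon)$ has a unique maximizer $p(\varepsilon)$, called the optimal price. Conventions: $p_1\equiv0$ throughout, and $p$ is identified with $(p_2,\dots,p_N)\in\mathbb{R}^{N-1}$; $\nabla_p\Phi$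 and $D^2_{p,p}\Phi$ denote the gradient and the $(N-1)\times(N-1)$ Hessian with respect to $(p_2,\dots,p_N)$. Let $$\mathcal{O}=\Big\{(p,\varepsilon):\ \varepsilon\in[0,1],\ \tfrac{1}{2N}<|C(p,\varepsilon)_i|<\tfrac{2}{N}\ \text{for every } i\Big\}$$ ($|\cdot|$ of a set denotes area); on $\mathcal{O}$ the derivatives $D^2_{p,p}\Phi$ and $\frac{\partial}{\partial\varepsilon}\nabla_p\Phi$ exist and $-D^2_{p,p}\Phi$ is positive definite. Algorithm: let $n$ be a positive integer and $h=1/n$. Set $p_0=p(0)$, the price vector (with first component $0$) such that all the horizontal strips $C(p(0),0)_i$ have area $1/N$. While $(p_k,kh)\in\mathcal{O}$ (and $k<n$), compute $A_k:=-D^2_{p,p}\Phi(p_k,kh)$ and $\delta_k:=\frac{\partial}{\partial\varepsilon}\nabla_p\Phi(p_k,kh)$, let $z_k$ be the solution of the linear system $A_kz_k=\delta_k$ (solved exactly), and set $p_{k+1}=p_k+hz_k$. (Here the subscript $k$ on $p_k$ denotes the iteration number, not a coordinate.) $p^h$ denotes the piecewise constant function equal to $p_k$ on $[kh,(k+1)h)$, for $k=0,\dots,n$ (restricted to $[0,1]$). *)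

(* Defs.v *)
From HB Require Import structures.
From mathcomp Require Import all_boot all_order all_algebra.
From mathcomp Require Import all_classical all_reals all_analysis.
Set Implicit Arguments.
Unset Strict Implicit.
Unset Printing Implicit Defensive.
Import Order.TTheory GRing.Theory Num.Theory numFieldNormedType.Exports.
Local Open Scope classical_set_scope.
Local Open Scope ring_scope.

Section Polygons.
Context {R : realType}.

Definition convex_hull k (v : 'I_k -> R * R) : set (R * R) :=
  [set x | exists t : 'I_k -> R,
    [/\ forall i, 0 <= t i, \sum_i t i = 1,
        x.1 = \sum_i t i * (v i).1 & x.2 = \sum_i t i * (v i).2]].

(* Polygons are closed.  Degenerate hulls (points, segments) are allowed here:
   they have area 0 and are excluded by asking for area 1. *)
Definition convex_polygon (Omega : set (R * R)) : Prop :=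
  exists k (v : 'I_k -> R * R), Omega = convex_hull v.

Definition area (A : set (R * R)) : \bar R :=
  (@lebesgue_measure R \x @lebesgue_measure R)%E A.

End Polygons.

(* Derivative at e of a function on [0, 1]: one-sided at both endpoints. *)
Definition derive01 {R : realType} (f : R -> R) (e : R) : R :=
  lim ((f t - f e) / (t - e) @[t --> within `[0, 1] e^']).

Definition enorm {R : realType} m (v : 'cV[R]_m) : R :=
  Num.sqrt (\sum_i v i 0 ^+ 2).

(* The number of points is N = m.+1.  A price vector (p_1, ..., p_N) with
   p_1 = 0 is represented by (p_2, ..., p_N) : 'cV_m; the point and the price
   numbered 1 in the mathematics have index ord0 : 'I_m.+1. *)
Section Euler.
Context {R : realType} {m : nat}.
Variables (Omega : set (R * R)) (y : 'I_m.+1 -> R * R).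
Implicit Types (p : 'cV[R]_m) (e : R).

Definition price p (i : 'I_m.+1) : R :=
  if unlift ord0 i is Some j then p j 0 else 0.

Definition cost e (x z : R * R) : R :=
  e * (x.1 - z.1) ^+ 2 + (x.2 - z.2) ^+ 2.

Definition net_cost p e (x : R * R) (i : 'I_m.+1) : R :=
  cost e x (y i) - price p i.

(* The neutral value net_cost p e x ord0 is itself one of the terms. *)
Definition min_net_cost p e (x : R * R) : R :=
  \big[Num.min/net_cost p e x ord0]_(i < m.+1) net_cost p e x i.

Definition Phi p e : R :=
  (m.+1)%:R^-1 * (\sum_(i < m.+1) price p i) +
  \int[(@lebesgue_measure R \x @lebesgue_measure R)%E]_(x in Omega)
    min_net_cost p e x.

Definition cell p e (i : 'I_m.+1) : set (R * R) :=
  [set x | Omega x /\ min_net_cost p e x = net_cost p e x i].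

Definition optimal_price e p : Prop := forall q, Phi q e <= Phi p e.

Definition grad_Phi p e : 'cV[R]_m :=
  \col_i 'D_(delta_mx i 0) (fun q => Phi q e) p.

Definition hess_Phi p e : 'M[R]_m :=
  \matrix_(i, j) 'D_(delta_mx j 0) (fun q => grad_Phi q e i 0) p.

Definition deps_grad_Phi p e : 'cV[R]_m :=
  \col_i derive01 (fun t => grad_Phi p t i 0) e.

Definition in_O p e : Prop :=
  0 <= e <= 1 /\
  forall i, ((2 * (m.+1)%:R)^-1%:E < area (cell p e i) < (2 / (m.+1)%:R)%:E)%E.

(* For Omega a convex polygon of area 1 and y with distinct second coordinates in
   Omega, on in_O the derivatives exist and - hess_Phi is positive definite, so
   invmx (- hess_Phi p e) *m deps_grad_Phi p e is the unique z solving
   - hess_Phi p e *m z = deps_grad_Phi p e. *)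
Definition euler_step (h : R) p e : 'cV[R]_m :=
  p + h *: (invmx (- hess_Phi p e) *m deps_grad_Phi p e).

(* The recursion is total; iterate k is the k-th iterate of the algorithm as
   long as iterates 0, ..., k - 1 satisfy the loop condition in_O. *)
Fixpoint euler (p0 : 'cV[R]_m) (n k : nat) : 'cV[R]_m :=
  if k is k'.+1 then
    euler_step n%:R^-1 (euler p0 n k') (k'%:R * n%:R^-1)
  else p0.

(* The index is the k such that k / n <= e < k.+1 / n. *)
Definition euler_fun (p0 : 'cV[R]_m) (n : nat) e : 'cV[R]_m :=
  euler p0 n (Num.truncn (e * n%:R)).

End Euler.

(* Main.v *)
(* The gradient of [Phi] in the price numbered [i] is [1 / N] minus the area of
   the cell [i], so the optimal price makes all areas equal, and one step of the
   algorithm is chosen so that the areas are stationary to first order along it.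
   Hence, as soon as the areas have a second order Taylor expansion with uniform
   constants, each step changes them by O(h^2) and they stay within O(h) of
   [1 / N]: no differential equation is needed.  A uniform strong monotonicity of
   the areas as functions of the prices turns this into |p_k - p(e)| = O(h).

   Taylor expansion.  As the second coordinates of the points differ, the
   interface of two cells lies on a graph over the first coordinate which is
   affine in that coordinate and in (p, e).  The area of a cell is thus the
   integral over the first coordinate of a slice length
   max(0, min of upper bounds - max of lower bounds), whose expansion is exact
   unless two of the bounds nearly coincide.  If all the cells have area at least
   [eta], the differences of two competing bounds are concave (or affine)
   functions exceeding a constant somewhere, since otherwise some cell would be
   thin; the set where such a function is O(r) has measure O(r).

   Strong monotonicity.  When the prices increase by [w], area flows only from
   cells with a smaller increment to cells with a larger one.  Cut the cells at a
   largest gap of the increments.  Two cells on either side of the cut contain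
   translates of a square; on the segment from a point of the first square to its
   translate there is a point that changes sides, so translation invariance
   bounds the transferred area from below. *)
Require Import Defs.
From HB Require Import structures.
From mathcomp Require Import all_boot all_order all_algebra.
From mathcomp Require Import all_classical all_reals all_analysis.
From mathcomp Require Import measurable_realfun ring lra.
Set Implicit Arguments.
Unset Strict Implicit.
Unset Printing Implicit Defensive.
Import Order.TTheory GRing.Theory Num.Theory numFieldNormedType.Exports.
Local Open Scope classical_set_scope.
Local Open Scope ring_scope.

(** * Minima of finite families *)

Section MinFamily.
Context {R : realType} {I : finType}.
Implicit Types (P : pred I) (g : R) (L d : I -> R).

(** [g] is itself a competitor. In the application it is a boundary of the polygon, which does not
    move, and the [L j] are interfaces with other cells. *)
Definition bmin P g L : R := \big[Num.min/g]_(j | P j) L j.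

Lemma bmin_le_id P g L : bmin P g L <= g.
Proof. exact: bigmin_le_id. Qed.

Lemma bmin_le P g L j : P j -> bmin P g L <= L j.
Proof. by move=> Pj; apply: bigmin_le_cond. Qed.

Lemma bmin_attained P g L :
  bmin P g L = g \/ exists2 j, P j & bmin P g L = L j.
Proof.
rewrite /bmin; apply: (big_ind (fun x => x = g \/ exists2 j, P j & x = L j)).
- by left.
- by move=> x y hx hy; rewrite /Num.min /Order.min; case: ifP.
- by move=> j Pj; right; exists j.
Qed.

Lemma le_bminP P g L x :
  x <= bmin P g L <-> x <= g /\ forall j, P j -> x <= L j.
Proof.
split=> [h|[hg hL]].
  split=> [|j Pj]; first exact: le_trans h (bmin_le_id _ _ _).
  exact: le_trans h (bmin_le _ _ Pj).
by case: (bmin_attained P g L) => [->|[j Pj ->]] //; exact: hL.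
Qed.

Definition strict_min P g L (j : I) : bool :=
  [&& P j, L j < g & [forall k, P k ==> (k != j) ==> (L j < L k)]].

Lemma strict_minP P g L j : reflect
  [/\ P j, L j < g & forall k, P k -> k != j -> L j < L k] (strict_min P g L j).
Proof.
apply: (iffP and3P) => -[Pj Lg h]; split=> //.
  by move=> k Pk kj; have /forallP/(_ k) := h; rewrite Pk kj.
by apply/forallP => k; apply/implyP => Pk; apply/implyP => kj; apply: h.
Qed.

(** The derivative of [bmin] in the direction [d] where the minimizer is unique. At ties, and where
    [g] wins, the value is 0, so the formula is linear in [d] everywhere. *)
Definition dbmin P g L d : R := \sum_j (strict_min P g L j)%:R * d j.

Definition separated P g L r := (forall j, P j -> r < `|g - L j|) /\
  (forall j k, P j -> P k -> j != k -> r < `|L j - L k|).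

Lemma bmin_lip P g L d e : 0 <= e -> (forall j, `|d j| <= e) ->
  `|bmin P g (fun j => L j + d j) - bmin P g L| <= e.
Proof.
move=> e0 de; have h1 : bmin P g L - e <= bmin P g (fun j => L j + d j).
  apply/le_bminP; split; first by have := bmin_le_id P g L; lra.
  move=> j Pj; have := bmin_le g L Pj.
  by have := de j; rewrite ler_norml => /andP[]; lra.
have h2 : bmin P g (fun j => L j + d j) - e <= bmin P g L.
  apply/le_bminP; split; first by have := bmin_le_id P g (fun j => L j + d j); lra.
  move=> j Pj; have := bmin_le g (fun j => L j + d j) Pj.
  by have := de j; rewrite ler_norml => /andP[]; lra.
by rewrite ler_norml; apply/andP; split; lra.
Qed.

Lemma dbmin_bound P g L d e : (forall j, `|d j| <= e) ->
  `|dbmin P g L d| <= #|I|%:R * e.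
Proof.
move=> de; apply: (le_trans (ler_norm_sum _ _ _)).
rewrite -sumr_const mulr_suml; apply: ler_sum => j _; rewrite mul1r.
by case: strict_min; rewrite ?mul1r // mul0r normr0; apply: le_trans (de j).
Qed.

(** Competitors more than [2 * e] apart cannot change order when each moves by at most [e], so the
    minimizer is kept. *)
Lemma bmin_exact P g L d e : 0 <= e -> (forall j, `|d j| <= e) ->
  separated P g L (2 * e) ->
  bmin P g (fun j => L j + d j) = bmin P g L + dbmin P g L d.
Proof.
move=> e0 de [sg sL].
have de' j : - e <= d j <= e by rewrite -ler_norml.
case: (bmin_attained P g L) => [E|[j Pj E]].
- have gL j : P j -> g + 2 * e < L j.
    move=> Pj; have := bmin_le g L Pj; rewrite E => gLj.
    by have := sg j Pj; rewrite ler0_norm ?subr_le0 //; lra.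
  rewrite /dbmin big1 ?addr0 => [|j _]; last first.
    case: strict_minP => [[Pj Ljg _]|]; last by rewrite mul0r.
    by have := gL j Pj; lra.
  apply/le_anti/andP; split; first by rewrite E bmin_le_id.
  apply/le_bminP; split; first by rewrite E.
  by move=> j Pj; rewrite E; have := gL j Pj; have := de' j; lra.
- have Lg : L j + 2 * e < g.
    have := bmin_le_id P g L; rewrite E => h.
    by have := sg j Pj; rewrite ger0_norm ?subr_ge0 //; lra.
  have LL k : P k -> k != j -> L j + 2 * e < L k.
    move=> Pk kj; have := bmin_le g L Pk; rewrite E => h.
    by have := sL k j Pk Pj kj; rewrite ger0_norm ?subr_ge0 //; lra.
  have sj : strict_min P g L j.
    apply/strict_minP; split=> // [|k Pk kj]; first lra.
    by have := LL k Pk kj; lra.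
  rewrite /dbmin (bigD1 j) //= sj mul1r big1 ?addr0 => [|k kj]; last first.
    case: strict_minP => [[Pk _ /(_ j Pj)]|]; last by rewrite mul0r.
    by rewrite eq_sym => /(_ kj); have := bmin_le g L Pk; rewrite E; lra.
  apply/le_anti/andP; split; first by rewrite E (bmin_le g (fun j => L j + d j) Pj).
  rewrite E; apply/le_bminP; split; first by have := de' j; lra.
  move=> k Pk; have [->//|kj] := eqVneq k j.
  by have := LL k Pk kj; have := de' j; have := de' k; lra.
Qed.

End MinFamily.

(** * Lengths of vertical slices and their first variation *)

Section SliceLength.
Context {R : realType} {I : finType}.
Implicit Types (P Q : pred I) (g h : R) (L d : I -> R).

Definition opps L := fun j => - L j : R.

(** Lower bounds enter with the opposite sign, so that both ends of a slice are minima; the fixed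
    lower bound is [- h]. *)
Definition gap P Q g h L : R := bmin P g L + bmin Q h (opps L).

Definition len P Q g h L : R := Num.max 0 (gap P Q g h L).

Definition dlen P Q g h L d : R :=
  (0 < gap P Q g h L)%R%:R * (dbmin P g L d + dbmin Q h (opps L) (opps d)).

Let opps_bound d e : (forall j, `|d j| <= e) -> forall j, `|opps d j| <= e.
Proof. by move=> de j; rewrite normrN. Qed.

Let oppsD L d : opps (fun j => L j + d j) = fun j => opps L j + opps d j.
Proof. by apply/funext => j; rewrite /opps opprD. Qed.

Lemma gap_lip P Q g h L d e : 0 <= e -> (forall j, `|d j| <= e) ->
  `|gap P Q g h (fun j => L j + d j) - gap P Q g h L| <= 2 * e.
Proof.
move=> e0 de; rewrite /gap oppsD.
have := bmin_lip P g L e0 de.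
have := bmin_lip Q h (opps L) e0 (opps_bound de).
by rewrite !ler_norml => /andP[? ?] /andP[? ?]; apply/andP; split; lra.
Qed.

Let maxr0_lip (x y e : R) : `|x - y| <= e -> `|Num.max 0 x - Num.max 0 y| <= e.
Proof.
rewrite !ler_norml => /andP[h1 h2].
by case: (leP 0 x) => ?; case: (leP 0 y) => ?; apply/andP; split; lra.
Qed.

Lemma len_lip P Q g h L d e : 0 <= e -> (forall j, `|d j| <= e) ->
  `|len P Q g h (fun j => L j + d j) - len P Q g h L| <= 2 * e.
Proof. by move=> e0 de; apply: maxr0_lip; apply: gap_lip. Qed.

Lemma dlen_bound P Q g h L d e : (forall j, `|d j| <= e) ->
  `|dlen P Q g h L d| <= (2 * #|I|%:R) * e.
Proof.
move=> de; rewrite /dlen.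
have := dbmin_bound P g L de.
have := dbmin_bound Q h (opps L) (opps_bound de).
rewrite !ler_norml => /andP[? ?] /andP[? ?].
by case: (_ < _); rewrite ?mul1r ?mul0r; apply/andP; split; lra.
Qed.

(** [gap] moves by at most [2 * e], so it keeps its sign and the truncation at 0 acts in the same
    way before and after. *)
Lemma len_exact P Q g h L d e : 0 <= e -> (forall j, `|d j| <= e) ->
  separated P g L (2 * e) -> separated Q h (opps L) (2 * e) ->
  2 * e < `|gap P Q g h L| ->
  len P Q g h (fun j => L j + d j) = len P Q g h L + dlen P Q g h L d.
Proof.
move=> e0 de sP sQ ge.
have Eg : gap P Q g h (fun j => L j + d j) = gap P Q g h L +
    (dbmin P g L d + dbmin Q h (opps L) (opps d)).
  rewrite /gap oppsD (bmin_exact e0 de sP).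
  by rewrite (bmin_exact e0 (opps_bound de) sQ); ring.
have := gap_lip P Q g h L e0 de.
rewrite /len /dlen Eg; move: (_ + dbmin _ _ _ _) => s.
rewrite ler_norml => /andP[h1 h2]; move: ge.
case: (ltP 0 (gap P Q g h L)) => [g0|g0].
  rewrite gtr0_norm // mul1r => ge.
  by rewrite !max_r //; lra.
rewrite ler0_norm // mul0r => ge.
by rewrite !max_l //; lra.
Qed.

(** Only first order in [e]: this serves on the exceptional set, whose measure is itself O(e). *)
Lemma len_taylor P Q g h L d e : 0 <= e -> (forall j, `|d j| <= e) ->
  `|len P Q g h (fun j => L j + d j) - len P Q g h L - dlen P Q g h L d|
    <= (2 + 2 * #|I|%:R) * e.
Proof.
move=> e0 de; have := len_lip P Q g h L e0 de.
have := dlen_bound P Q g h L de.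
by rewrite !ler_norml => /andP[? ?] /andP[? ?]; apply/andP; split; lra.
Qed.

End SliceLength.

(** * Concave functions on an interval *)

Section ConcaveOn.
Context {R : realType}.
Implicit Types (J : set R) (phi psi : R -> R) (D kap r c d a b xm th : R).

Definition concave_on J phi := forall s t th, J s -> J t -> 0 <= th <= 1 ->
  (1 - th) * phi s + th * phi t <= phi ((1 - th) * s + th * t).

Lemma is_interval_conv J s t th : is_interval J -> J s -> J t ->
  0 <= th <= 1 -> J ((1 - th) * s + th * t).
Proof.
move=> iJ Js Jt /andP[th0 th1]; case: (leP s t) => st.
  by apply: (iJ s t) => //; apply/andP; split; nra.
by apply: (iJ t s) => //; apply/andP; split; nra.
Qed.

Lemma concave_on_affine J a b : concave_on J (fun x => a + b * x).
Proof. by move=> s t th _ _ _; rewrite le_eqVlt; apply/orP; left; apply/eqP; ring. Qed.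

Lemma concave_onD J phi psi : concave_on J phi -> concave_on J psi ->
  concave_on J (fun x => phi x + psi x).
Proof.
move=> h1 h2 s t th Js Jt th01.
by have := h1 _ _ _ Js Jt th01; have := h2 _ _ _ Js Jt th01; lra.
Qed.

Lemma concave_on_bmin (I : finType) J (P : pred I) phi (L : I -> R -> R) :
  concave_on J phi -> (forall j, P j -> concave_on J (L j)) ->
  concave_on J (fun x => bmin P (phi x) (fun j => L j x)).
Proof.
move=> hphi hL s t th Js Jt th01; have /andP[th0 th1] := th01.
set u := _ + _; have [hs ht] : 0 <= 1 - th /\ 0 <= th by lra.
apply/le_bminP; split.
  apply: le_trans (hphi _ _ _ Js Jt th01).
  by apply: lerD; apply: ler_wpM2l => //; apply: bmin_le_id.
move=> j Pj; apply: le_trans (hL j Pj _ _ _ Js Jt th01).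
by apply: lerD; apply: ler_wpM2l => //; apply: (bmin_le _ _ Pj).
Qed.

Lemma superlevel_conv J phi c s t x : is_interval J -> concave_on J phi ->
  J s -> J t -> c <= phi s -> c <= phi t -> s <= x <= t -> c <= phi x.
Proof.
move=> iJ cphi Js Jt cs ct /andP[sx xt].
have [st|st] := leP t s; first by have -> : x = s by lra.
pose th := (x - s) / (t - s).
have ts : 0 < t - s by lra.
have th01 : 0 <= th <= 1.
  by rewrite /th ler_pdivlMr // ler_pdivrMr //; apply/andP; split; lra.
have -> : x = (1 - th) * s + th * t.
  by rewrite /th; field; lra.
by apply: le_trans (cphi _ _ _ Js Jt th01); move: th01 => /andP[]; nra.
Qed.

Lemma superlevel_le_is_interval J phi c : is_interval J -> concave_on J phi ->
  is_interval [set x | J x /\ c <= phi x].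
Proof.
move=> iJ cphi s t [Js cs] [Jt ct] x sxt; split; first exact: (iJ s t).
exact: (superlevel_conv iJ cphi Js Jt).
Qed.

Lemma superlevel_lt_is_interval J phi c : is_interval J -> concave_on J phi ->
  is_interval [set x | J x /\ c < phi x].
Proof.
move=> iJ cphi s t [Js cs] [Jt ct] x sxt; split; first exact: (iJ s t).
have: Num.min (phi s) (phi t) <= phi x.
  by apply: (superlevel_conv iJ cphi Js Jt) => //; rewrite ge_min lexx ?orbT.
by apply: lt_le_trans; rewrite lt_min cs ct.
Qed.

(** An interval centred at any point of [S] will do; this doubles the length but avoids suprema. *)
Lemma diameter_cover (S : set R) d : 0 <= d ->
  (forall x y, S x -> S y -> x <= y -> y - x <= d) ->
  exists B, [/\ measurable B, (lebesgue_measure B <= (2 * d)%:E)%E & S `<=` B].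
Proof.
move=> d0 hS; have [[x0 Sx0]|S0] := pselect (S !=set0); last first.
  exists set0; split=> //; first by rewrite measure0 lee_fin; lra.
  by move=> x Sx; apply: S0; exists x.
exists `[x0 - d, x0 + d]%classic; split; first exact: measurable_itv.
  rewrite lebesgue_measure_itv /= lte_fin; case: ifP => _.
    by rewrite -EFinB lee_fin; lra.
  by rewrite lee_fin; lra.
move=> x Sx /=; rewrite in_itv /=.
case: (leP x x0) => xx0; first by have := hS _ _ Sx Sx0 xx0; lra.
by have := hS _ _ Sx0 Sx (ltW xx0); lra.
Qed.

(* Beyond a point where it is at least [kap], a concave function descends with
   slope at least [kap / (2 * D)], so it crosses the band [-r, r] quickly. *)
Lemma concave_band_cover J phi D kap xm r : is_interval J -> concave_on J phi ->
  (forall x, J x -> - D <= x <= D) -> 0 < D -> J xm -> 0 < kap -> kap <= phi xm ->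
  0 <= r ->
  exists B, [/\ measurable B, (lebesgue_measure B <= (16 * D / kap * r)%:E)%E &
    forall x, J x -> `|phi x| <= r -> B x].
Proof.
move=> iJ cphi JD D0 Jm kap0 kapm r0; pose d := 4 * D * r / kap.
have d0 : 0 <= d by rewrite divr_ge0 ?mulr_ge0 //; lra.
(* For [u] between [xm] and [v], both in the band, concavity gives [(1 - th) * kap <= 2 * r], while
   [v - u = (1 - th) * (v - xm)] and [xm], [v] are at most [2 * D] apart. *)
have key u v : J v -> `|phi u| <= r -> `|phi v| <= r ->
    (exists2 th, 0 <= th <= 1 & u = (1 - th) * xm + th * v) ->
    `|v - u| <= d.
  rewrite !ler_norml => Jv /andP[_ ur] /andP[vr _] [th th01 ue].
  have := cphi _ _ _ Jm Jv th01; rewrite -ue => h.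
  have /andP[th0 th1] := th01.
  have h1 : (1 - th) * kap <= 2 * r by nra.
  have -> : v - u = (1 - th) * (v - xm) by rewrite ue; ring.
  have := JD _ Jv; have := JD _ Jm => /andP[? ?] /andP[? ?].
  rewrite -ler_norml normrM ger0_norm; last lra.
  have h2 : `|v - xm| <= 2 * D by rewrite ler_norml; lra.
  rewrite /d ler_pdivlMr //.
  apply: (@le_trans _ _ ((1 - th) * kap * (2 * D))); last by nra.
  have : 0 <= (1 - th) * kap * (2 * D - `|v - xm|) by rewrite !mulr_ge0 //; lra.
  lra.
(* The band is cut at [xm]. Each half has diameter at most [d], and two covers of length [2 * d]
   give the constant 16. *)
have [|B1 [mB1 lB1 sB1]] := @diameter_cover
  [set x | [/\ J x, `|phi x| <= r & xm <= x]] d d0.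
  move=> u v [Ju ur mu] [Jv vr mv] uv.
  apply: le_trans (ler_norm _) _; apply: key => //.
  have [E|lt] := leP v xm.
    by exists 0; [rewrite lexx ler01|lra].
  exists ((u - xm) / (v - xm)); last by field; lra.
  have ? : 0 < v - xm by lra.
  by rewrite ler_pdivlMr // ler_pdivrMr //; lra.
have [|B2 [mB2 lB2 sB2]] := @diameter_cover
  [set x | [/\ J x, `|phi x| <= r & x <= xm]] d d0.
  move=> v u [Jv vr mv] [Ju ur mu] vu.
  apply: le_trans (ler_norm _) _; rewrite distrC; apply: key => //.
  have [E|lt] := leP xm v.
    by exists 0; [rewrite lexx ler01|lra].
  exists ((u - xm) / (v - xm)); last by field; lra.
  have ? : 0 < xm - v by lra.
  rewrite -mulrNN -invrN !opprB ler_pdivlMr // ler_pdivrMr //; lra.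
exists (B1 `|` B2); split; first exact: measurableU.
  apply: (le_trans (measureU2 _ _ _)) => //.
  apply: (le_trans (leeD lB1 lB2)); rewrite -EFinD lee_fin /d.
  by rewrite le_eqVlt; apply/orP; left; apply/eqP; field; lra.
move=> x Jx xr; case: (leP xm x) => h; first by left; apply: sB1.
by right; apply: sB2; split=> //; apply: ltW.
Qed.

(** An affine function stays concave when negated, so its sign at [xm] does not matter. *)
Lemma affine_band_cover J D kap a b xm r : is_interval J ->
  (forall x, J x -> - D <= x <= D) -> 0 < D -> J xm -> 0 < kap ->
  kap <= `|a + b * xm| -> 0 <= r ->
  exists B, [/\ measurable B, (lebesgue_measure B <= (16 * D / kap * r)%:E)%E &
    forall x, J x -> `|a + b * x| <= r -> B x].
Proof.
move=> iJ JD D0 Jm kap0 kapm r0; case: (leP 0 (a + b * xm)) => s.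
  by apply: (concave_band_cover iJ _ JD D0 Jm kap0 _ r0);
    [exact: concave_on_affine|rewrite ger0_norm in kapm].
have [||B [mB lB hB]] := @concave_band_cover J (fun x => - a + (- b) * x) D kap xm r
  iJ _ JD D0 Jm kap0 _ r0.
- exact: concave_on_affine.
- by rewrite ltr0_norm // in kapm; lra.
exists B; split=> // x Jx xr; apply: hB => //.
by rewrite mulNr -opprD normrN.
Qed.

End ConcaveOn.

(** * Finite covers and translations *)

Section FiniteCovers.
Context {d} {T : measurableType d} {R : realType}.
Variable mu : {measure set T -> \bar R}.

Lemma measure_finite_cover (I : finType) (P : pred I) (A : set T)
    (F : I -> set T) : measurable A -> (forall i, measurable (F i)) ->
  (forall x, A x -> exists2 i, P i & F i x) ->
  (mu A <= \sum_(i | P i) mu (F i))%E.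
Proof.
move=> mA mF AF; pose U s := \big[setU/set0]_(i <- s | P i) F i.
have mU s : measurable (U s) by apply: bigsetU_measurable.
have lU s : (mu (U s) <= \sum_(i <- s | P i) mu (F i))%E.
  elim: s => [|i s ih]; rewrite /U; first by rewrite !big_nil measure0.
  rewrite !big_cons; case: (P i) => //.
  apply: (le_trans (measureU2 _ _ _)) => //; first exact: mU.
  by apply: leeD.
apply: le_trans (lU _); apply: le_measure; rewrite ?inE //.
move=> x /AF[i Pi Fx]; rewrite /U -bigcup_seq_cond.
by exists i => //=; rewrite mem_index_enum Pi.
Qed.

(** Pieces are added one at a time; each meets the union of those already taken only inside the null
    set [Z]. *)
Lemma measure_ae_partition (I : finType) (A : set T) (F : I -> set T)
    (Z : set T) : measurable A -> (mu A < +oo)%E ->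
  (forall i, measurable (F i)) -> (forall x, A x -> exists i, F i x) ->
  measurable Z -> mu Z = 0%E ->
  (forall i j x, i != j -> F i x -> F j x -> Z x) ->
  mu A = (\sum_i mu (A `&` F i))%E.
Proof.
move=> mA Afin mF AF mZ Z0 ovl.
pose U s := \big[setU/set0]_(i <- s) (A `&` F i).
have mU s : measurable (U s).
  by apply: bigsetU_measurable => i _; exact: measurableI.
have UP s x : U s x <-> exists2 i, i \in s & A x /\ F i x.
  by rewrite /U -bigcup_seq; split=> -[i /= si h]; exists i.
have subA B : measurable B -> B `<=` A -> (mu B < +oo)%E.
  move=> mB BA; apply: le_lt_trans Afin.
  by apply: le_measure; rewrite ?inE.
have muU s : uniq s -> mu (U s) = (\sum_(i <- s) mu (A `&` F i))%E.
  elim: s => [|i s ih] /=; first by rewrite /U !big_nil measure0.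
  move=> /andP[nis us]; rewrite {1}/U !big_cons -/(U s) measureUfinl //.
  - rewrite ih // (_ : mu (_ `&` U s) = 0%E) ?sube0 //.
    apply: (@subset_measure0 _ _ _ mu _ Z) => //.
      by apply: measurableI => //; apply: measurableI.
    move=> x [[Ax Fi] /UP[j js [Ax' Fj]]]; apply: (ovl i j) => //.
    by apply: contraNneq nis => ->.
  - exact: measurableI.
  - by apply: subA; [exact: measurableI|move=> x []].
rewrite -big_enum /= -muU ?enum_uniq //; congr (mu _).
apply/seteqP; split=> x.
  by move=> Ax; apply/UP; have [i Fi] := AF x Ax; exists i; rewrite ?mem_enum.
by move=> /UP[i ? []].
Qed.

End FiniteCovers.

(** * Translation invariance of the area *)

Section Translation.
Context {R : realType}.
Local Notation RT := (measurableTypeR R).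
Local Notation lam := (@lebesgue_measure R).
Local Notation mu2 := (lam \x lam)%E.

Definition translate (v x : R * R) : R * R := (x.1 + v.1, x.2 + v.2).

Let shiftm (c : R) : RT -> RT := fun x => x + c.

Let measurable_shiftm c : measurable_fun setT (shiftm c).
Proof. by apply: (@measurable_funD _ RT R setT id (cst c)). Qed.

Lemma lebesgue_measure_shift (c : R) (A : set RT) : measurable A ->
  lam ((fun x => x + c) @^-1` A) = lam A.
Proof.
move=> mA; apply/esym.
apply: (@lebesgue_measure_unique R (pushforward lam (shiftm c))) => //.
move=> _ [[a b] _ <-] /=.
rewrite /pushforward (_ : _ @^-1` _ = `]a - c, b - c]%classic).
  rewrite !lebesgue_measure_itv /= !lte_fin ltrD2r; case: ifP => // _.
  by rewrite -!EFinB; congr EFin; ring.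
by apply/seteqP; split=> x; rewrite /= !in_itv /= ltrBlDr lerBrDr.
Qed.

Lemma measurable_translate v : measurable_fun setT (translate v : RT * RT -> RT * RT).
Proof.
apply/measurable_fun_pairP; split.
  by apply: (@measurable_funD _ _ R setT (fst : RT * RT -> R) (cst v.1)).
by apply: (@measurable_funD _ _ R setT (snd : RT * RT -> R) (cst v.2)).
Qed.

(** Both sides are measures in [A] that agree on rectangles, by invariance in each coordinate, and
    these values determine the product measure. *)
Lemma area_translate v (A : set (RT * RT)) : measurable A ->
  mu2 (translate v @^-1` A) = mu2 A.
Proof.
move=> mA; have mt := measurable_translate v; apply/esym.
apply: (@product_measure_unique _ _ RT RT R lam lam
  (pushforward mu2 (translate v : RT * RT -> RT * RT))) => //.
move=> B C mB mC.
change (mu2 (((fun x => x + v.1) @^-1` B) `*` ((fun x => x + v.2) @^-1` C)) =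
  (lam B * lam C)%E).
rewrite product_measure1E.
- by congr (_ * _)%E; exact: lebesgue_measure_shift.
- by rewrite -[X in measurable X]setTI; apply: measurable_shiftm.
- by rewrite -[X in measurable X]setTI; apply: measurable_shiftm.
Qed.

End Translation.

(* Pigeonhole: the [n.+1] values, two of which bound [x0, x0 + l], cannot meet
   all [n.+1] open intervals of length [l / n.+1] that subdivide it. *)
Lemma value_gap {R : realType} (n : nat) (w : 'I_n.+1 -> R) a b :
  w a < w b -> exists c : R, [/\ w a <= c, c + (w b - w a) / n.+1%:R <= w b &
    forall k, w k <= c \/ c + (w b - w a) / n.+1%:R <= w k].
Proof.
move=> ab; set g := _ / _; have n0 : 0 < n.+1%:R :> R by rewrite ltr0n.
have g0 : 0 < g by rewrite divr_gt0 // subr_gt0.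
have Eg : w a + n.+1%:R * g = w b by rewrite /g; field; lra.
pose lo (t : 'I_n.+1) := w a + t%:R * g.
have [[t ht]|hn] := pselect (exists t, forall k, w k <= lo t \/ lo t + g <= w k).
  exists (lo t); split=> //; first by rewrite /lo lerDl mulr_ge0 // ltW.
  rewrite -Eg /lo -addrA lerD2l -[X in _ + X]mul1r -mulrDl ler_wpM2r ?(ltW g0) //.
  by rewrite natr1 ler_nat.
(* Otherwise each open interval from [lo t] to [lo t + g] contains some value, and [f] selects its
   index. *)
have /choice[f hf] : forall t, exists k, lo t < w k /\ w k < lo t + g.
  move=> t; apply: contrapT => h; apply: hn; exists t => k.
  case: (leP (w k) (lo t)) => h1; first by left.
  by right; rewrite leNgt; apply/negP => h2; apply: h; exists k.
have injf : injective f.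
  have lt_neq (s t : 'I_n.+1) : (s < t)%N -> f s = f t -> False.
    move=> st E; have [_] := hf s; have [] := hf t; rewrite -E => h1 h2.
    have : lo s + g <= lo t.
      rewrite /lo -addrA lerD2l -[X in _ + X]mul1r -mulrDl ler_wpM2r ?(ltW g0) //.
      by rewrite natr1 ler_nat.
    by lra.
  move=> s t E; apply/val_inj => /=; case: (ltngtP s t) => // h.
    by case: (lt_neq s t).
  by case: (lt_neq t s).
(* The intervals are disjoint, so [f] is injective, hence onto: one of the open intervals would
   contain [w a], the left end of them all. *)
have /codomP[t Et] := injF_onto injf a.
have [] := hf t; rewrite -Et => h _.
have : w a <= lo t by rewrite /lo lerDl mulr_ge0 // ltW.
by lra.
Qed.

(** * Derivatives from quadratic error bounds *)

Lemma le_of_linear_error {R : realFieldType} (a b C : R) : 0 <= C ->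
  (forall t, 0 < t -> a <= b + C * t) -> a <= b.
Proof.
move=> C0 h; apply/ler_addgt0Pr => d d0; have C1 : 0 < C + 1 by lra.
apply: le_trans (h (d / (C + 1)) _) _; first exact: divr_gt0.
by rewrite lerD2l mulrA ler_pdivrMr // mulrC ler_wpM2l //; lra.
Qed.

Lemma cvg_linear_error {R : realType} {T : Type} (F : set_system T)
    (u v : T -> R) (l : R) : ProperFilter F ->
  v t @[t --> F] --> 0 -> (\forall t \near F, `|u t - l| <= v t) ->
  lim (u t @[t --> F]) = l.
Proof.
move=> FF v0 uv; apply: cvg_lim => //; apply/cvgrPdist_le => e e0.
have /cvgrPdist_le/(_ e e0) v1 := v0.
near=> t; rewrite distrC; apply: (@le_trans _ _ (v t)); first by near: t.
apply: le_trans (ler_norm _) _; rewrite -normrN -sub0r.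
by near: t.
Unshelve. all: by end_near. Qed.

(** The difference quotient is within [C * |t|] of [d]. Taylor estimates thereby give the values of
    the gradient and the Hessian, which are defined as limits. *)
Lemma derive_quadratic_error {R : realType} {V : normedModType R} (f : V -> R)
    (p v : V) (d C : R) :
  (forall t : R, `|f (p + t *: v) - f p - t * d| <= C * t ^+ 2) ->
  'D_v f p = d.
Proof.
move=> hf; rewrite /derive; apply: (@cvg_linear_error _ _ _ _ (fun t => C * `|t|)).
  rewrite -[X in _ --> X](mulr0 C); apply: cvgMr.
  by rewrite -[X in _ --> X](normr0 R); apply: cvg_norm; exact: cvg_within.
near=> t; have t0 : t != 0 by near: t; exact: nbhs_dnbhs_neq.
rewrite /= (addrC (t *: v)).
have -> : t^-1 *: (f (p + t *: v) - f p) - d = t^-1 * (f (p + t *: v) - f p - t * d).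
  by rewrite mulrBr mulKf.
rewrite normrM normfV -(ler_pM2l (x := `|t|)) ?normr_gt0 //.
rewrite mulVKf ?normr_eq0 //; apply: le_trans (hf t) _.
by rewrite [leRHS]mulrCA -normrM -expr2 ger0_norm ?sqr_ge0.
Unshelve. all: by end_near. Qed.

(** Uniqueness of the limit in [derive01], in particular at the endpoints, rests on this. *)
Lemma within01_dnbhs_proper {R : realType} (e : R) : 0 <= e <= 1 ->
  ProperFilter (within `[0, 1] e^').
Proof.
move=> e01; apply: Build_ProperFilter_ex => P.
rewrite /within /= /dnbhs /within /= => /nbhs_ballP[r /= r0 hr].
pose d := Num.min (r / 2) (2^-1).
have d0 : 0 < d by rewrite lt_min; apply/andP; split; lra.
have d1 : d <= r / 2 by rewrite ge_min lexx.
have d2 : d <= 2^-1 by rewrite ge_min lexx orbT.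
(* Step to the right from the left half of the interval and to the left from the right half; a
   length of at most 1/2 stays inside. *)
have [e2|e2] := leP e 2^-1.
  exists (e + d); apply: hr => /=.
  - rewrite /ball /= opprD addrA subrr sub0r normrN gtr0_norm //; lra.
  - by apply/eqP; lra.
  - by rewrite in_itv /=; lra.
exists (e - d); apply: hr => /=.
- rewrite /ball /= opprB addrCA subrr addr0 gtr0_norm //; lra.
- by apply/eqP; lra.
- by rewrite in_itv /=; lra.
Qed.

Lemma derive01_quadratic_error {R : realType} (f : R -> R) (e d C : R) :
  0 <= e <= 1 ->
  (forall t, 0 <= t <= 1 -> `|f t - f e - (t - e) * d| <= C * (t - e) ^+ 2) ->
  derive01 f e = d.
Proof.
move=> e01 hf; have PF := within01_dnbhs_proper e01.
rewrite /derive01; apply: (@cvg_linear_error _ _ _ _ (fun t => C * `|t - e|)) => //.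
  rewrite -[X in _ --> X](mulr0 C); apply: cvgMr.
  rewrite -[X in _ --> X](normr0 R); apply: cvg_norm.
  rewrite -(subrr e); apply: cvgB; last exact: cvg_cst.
  by move=> A nA; apply: filterS nA.
rewrite near_withinE; near=> t => t01.
have te : t - e != 0 by rewrite subr_eq0; near: t; exact: nbhs_dnbhs_neq.
have -> : (f t - f e) / (t - e) - d = (t - e)^-1 * (f t - f e - (t - e) * d).
  by rewrite mulrBr mulKf // mulrC.
rewrite normrM normfV -(ler_pM2l (x := `|t - e|)) ?normr_gt0 //.
rewrite mulVKf ?normr_eq0 //; apply: le_trans (hf t _) _.
  by move: t01; rewrite /= in_itv.
by rewrite [leRHS]mulrCA -normrM -expr2 ger0_norm ?sqr_ge0.
Unshelve. all: by end_near. Qed.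

(** * Convex polygons *)

Section Polygon.
Context {R : realType}.

Let lin k (c : 'I_k -> R) (t : 'rV[R]_k) : R := \sum_i t 0 i * c i.

Let lin_continuous k (c : 'I_k -> R) : continuous (lin c).
Proof.
move=> t; rewrite /lin; apply: (@continuous_big R _ +%R 0) => [|i _].
  exact: add_continuous.
move=> u; apply: (@cvgMr_tmp R _ (nbhs u) _ (fun t : 'rV[R]_k => t 0 i)).
exact: (@coord_continuous R 1 k 0 i u).
Qed.

(** The admissible weights form a compact set. This makes the top and the bottom of each vertical
    section of a hull attained. *)
Lemma simplex_slice_max k (c d : 'I_k -> R) (a : R) (t0 : 'rV[R]_k) :
  (forall i, 0 <= t0 0 i) -> \sum_i t0 0 i = 1 -> \sum_i t0 0 i * d i = a ->
  exists t : 'rV[R]_k, [/\ forall i, 0 <= t 0 i, \sum_i t 0 i = 1,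
    \sum_i t 0 i * d i = a &
    forall s : 'rV[R]_k, (forall i, 0 <= s 0 i) -> \sum_i s 0 i = 1 ->
      \sum_i s 0 i * d i = a -> \sum_i s 0 i * c i <= \sum_i t 0 i * c i].
Proof.
move=> p0 s0 d0.
pose box := [set v : 'rV[R]_k | forall i, v ord0 i \in `[0, 1]].
pose K := box `&` ([set v | lin (cst 1) v = 1] `&` [set v | lin d v = a]).
have KE v : K v <-> [/\ forall i, 0 <= v 0 i, \sum_i v 0 i = 1 & \sum_i v 0 i * d i = a].
  have l1 : lin (cst 1) v = \sum_i v 0 i.
    by rewrite /lin; apply: eq_bigr => i _; rewrite mulr1.
  split=> [[bv [/=]]|[v0 v1 vd]].
    rewrite l1 => v1 vd; split=> // i.
    by have := bv i; rewrite in_itv /= => /andP[].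
  split; last by split=> //=; rewrite l1.
  move=> i; rewrite in_itv /= v0 /= -v1 (bigD1 i) //= lerDl.
  by apply: sumr_ge0 => j _.
have cK : compact K.
  have cb : compact box.
    apply: (@rV_compact R k (fun=> `[0, 1]%classic)) => i.
    exact: segment_compact.
  apply: (subclosed_compact _ cb) => [|v []//].
  apply: closedI; first by apply: compact_closed => //; exact: norm_hausdorff.
  by apply: closedI; apply: (@preimage_closed _ _ (lin _) [set u | u = _]);
    [move=> v _; exact: lin_continuous|exact: closed_eq|
     move=> v _; exact: lin_continuous|exact: closed_eq].
have Kt0 : K t0 by apply/KE.
have [||t tK tmax] := @EVT_max_rV R k (lin c) K _ cK.
- by exists t0.
- by apply: continuous_subspaceT; exact: lin_continuous.
move/set_mem/KE: tK => [t1 t2 t3]; exists t; split=> // s s1 s2 s3.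
by apply: tmax; apply/mem_set/KE.
Qed.

Lemma convex_hull_conv k (v : 'I_k -> R * R) a b th :
  convex_hull v a -> convex_hull v b -> 0 <= th <= 1 ->
  convex_hull v ((1 - th) * a.1 + th * b.1, (1 - th) * a.2 + th * b.2).
Proof.
move=> [s [s0 s1 sa1 sa2]] [t [t0 t1 tb1 tb2]] /andP[th0 th1].
exists (fun i => (1 - th) * s i + th * t i); split.
- by move=> i; rewrite addr_ge0 // mulr_ge0 // subr_ge0.
- by rewrite big_split /= -!mulr_sumr s1 t1; ring.
- rewrite sa1 tb1 !mulr_sumr -big_split /=.
  by apply: eq_bigr => i _; ring.
- rewrite sa2 tb2 !mulr_sumr -big_split /=.
  by apply: eq_bigr => i _; ring.
Qed.

Lemma convex_hull_slice_max k (v : 'I_k -> R * R) (c : 'I_k -> R) x1 x2 :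
  convex_hull v (x1, x2) ->
  exists t : 'rV[R]_k, convex_hull v (x1, \sum_i t 0 i * (v i).2) /\
   forall s : 'I_k -> R, (forall i, 0 <= s i) -> \sum_i s i = 1 ->
     x1 = \sum_i s i * (v i).1 -> \sum_i s i * c i <= \sum_i t 0 i * c i.
Proof.
move=> [s [s0 s1 sx _]].
have E (u : 'I_k -> R) (f : R -> 'I_k -> R) :
    \sum_i f ((\row_j u j) 0 i) i = \sum_i f (u i) i.
  by apply: eq_bigr => i _; rewrite mxE.
have [||| t [t0 t1 tx tmax]] := @simplex_slice_max k c (fun i => (v i).1) x1 (\row_j s j).
- by move=> i; rewrite mxE.
- by rewrite (E s (fun u _ => u)).
- by rewrite (E s (fun u i => u * (v i).1)).
exists t; split; first by exists (fun i => t 0 i).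
move=> u u0 u1 ux; rewrite -(E u (fun u i => u * c i)); apply: tmax.
- by move=> i; rewrite mxE.
- by rewrite (E u (fun u _ => u)).
- by rewrite (E u (fun u i => u * (v i).1)).
Qed.

Lemma convex_hull_bounded k (v : 'I_k -> R * R) :
  exists2 D : R, 0 < D & forall x, convex_hull v x -> `|x.1| <= D /\ `|x.2| <= D.
Proof.
pose D := 1 + \sum_i (`|(v i).1| + `|(v i).2|).
have S0 : 0 <= \sum_i (`|(v i).1| + `|(v i).2|) by apply: sumr_ge0 => i _; rewrite addr_ge0.
exists D; first by rewrite /D; lra.
move=> x [t [t0 t1 -> ->]].
have t_le1 i : t i <= 1.
  by rewrite -t1 (bigD1 i) //= lerDl; apply: sumr_ge0 => j _.
have key (c : 'I_k -> R) : (forall i, `|c i| <= `|(v i).1| + `|(v i).2|) ->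
    `|\sum_i t i * c i| <= D.
  move=> hc; apply: (le_trans (ler_norm_sum _ _ _)); rewrite /D.
  apply: (@le_trans _ _ (\sum_i (`|(v i).1| + `|(v i).2|))); last by lra.
  apply: ler_sum => i _; rewrite normrM (ger0_norm (t0 i)) -[leRHS]mul1r.
  by apply: ler_pM.
by split; apply: key => i; rewrite ?lerDl ?lerDr.
Qed.

(** The only form in which the polygon is used later. Its convexity makes [g] and [h] concave; the
    lower boundary is the graph of [- h]. *)
Lemma polygon_graph (Omega : set (R * R)) : convex_polygon Omega ->
  exists (J : set R) (g h : R -> R) (D : R),
  [/\ is_interval J, concave_on J g, concave_on J h,
      Omega = [set x : R * R | J x.1 /\ - h x.1 <= x.2 <= g x.1] &
      0 < D /\ forall x, J x -> [/\ - D <= x <= D, g x <= D & h x <= D]].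
Proof.
move=> [k [v ->]]; set Om := convex_hull v.
pose J := [set x1 | exists x2, Om (x1, x2)].
(* The boundary functions need a value outside [J] as well; 0 is an arbitrary choice there. *)
have top_ex x1 : exists t2, J x1 -> Om (x1, t2) /\ forall x2, Om (x1, x2) -> x2 <= t2.
  have [[x2 Ox]|nJ] := pselect (J x1); last by exists 0.
  have [t [Ot tmax]] := convex_hull_slice_max (fun i => (v i).2) Ox.
  by exists (\sum_i t 0 i * (v i).2) => _; split=> // z2 [s [s0 s1 /= sx ->]]; apply: tmax.
have bot_ex x1 : exists t2, J x1 -> Om (x1, - t2) /\ forall x2, Om (x1, x2) -> - x2 <= t2.
  have [[x2 Ox]|nJ] := pselect (J x1); last by exists 0.
  have [t [Ot tmax]] := convex_hull_slice_max (fun i => - (v i).2) Ox.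
  exists (\sum_i t 0 i * - (v i).2) => _; split.
    by rewrite -sumrN; under eq_bigr do rewrite mulrN opprK.
  move=> z2 [s [s0 s1 /= sx ->]].
  rewrite (_ : - _ = \sum_i s i * - (v i).2); first exact: tmax.
  by rewrite -sumrN; apply: eq_bigr => i _; rewrite mulrN.
have /choice[g hg] := top_ex; have /choice[h hh] := bot_ex.
have [D D0 OD] := convex_hull_bounded v.
have Jconv s t th : J s -> J t -> 0 <= th <= 1 -> J ((1 - th) * s + th * t).
  move=> [s2 Os] [t2 Ot] th01.
  by exists ((1 - th) * s2 + th * t2); exact: (convex_hull_conv Os Ot th01).
have cg : concave_on J g.
  move=> s t th Js Jt th01; have [_ gmax] := hg _ (Jconv _ _ _ Js Jt th01).
  apply: gmax; exact: (convex_hull_conv (hg s Js).1 (hg t Jt).1 th01).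
have ch : concave_on J h.
  move=> s t th Js Jt th01; have [_ hmax] := hh _ (Jconv _ _ _ Js Jt th01).
  have := hmax _ (convex_hull_conv (hh s Js).1 (hh t Jt).1 th01).
  by rewrite /= !mulrN -opprD opprK.
have iJ : is_interval J.
  move=> s t Js Jt x /andP[sx xt].
  have [st|st] := leP t s; first by have -> : x = s by lra.
  have ts : 0 < t - s by lra.
  have -> : x = (1 - (x - s) / (t - s)) * s + (x - s) / (t - s) * t by field; lra.
  apply: Jconv => //.
  by rewrite ler_pdivlMr // ler_pdivrMr //; apply/andP; split; lra.
exists J, g, h, D; split=> //.
  apply/seteqP; split=> -[x1 x2] /=.
    move=> Ox; have Jx : J x1 by exists x2.
    split=> //; rewrite (proj2 (hg _ Jx)) // andbT lerNl.
    exact: (proj2 (hh _ Jx)).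
  move=> [Jx /andP[hx gx]]; have [Og _] := hg _ Jx; have [Oh _] := hh _ Jx.
  have [gh|gh] := leP (g x1) (- h x1).
    by have -> : x2 = g x1 by lra.
  (* A point between the bottom and the top of its vertical section is a convex combination of the
     two. *)
  pose th := (x2 + h x1) / (g x1 + h x1).
  have den : 0 < g x1 + h x1 by lra.
  have th01 : 0 <= th <= 1.
    by rewrite /th ler_pdivlMr // ler_pdivrMr //; apply/andP; split; lra.
  have := convex_hull_conv Oh Og th01; rewrite /=.
  rewrite (_ : (1 - th) * x1 + th * x1 = x1); last by ring.
  by rewrite (_ : (1 - th) * - h x1 + th * g x1 = x2) // /th; field; lra.
split=> // x Jx; have [Og _] := hg _ Jx; have [Oh _] := hh _ Jx.
have [/= x1D gD] := OD _ Og; have [_ /= hD] := OD _ Oh.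
rewrite -ler_norml; split=> //; first exact: le_trans (ler_norm _) gD.
by move: hD; rewrite normrN; apply: le_trans; exact: ler_norm.
Qed.

End Polygon.

(** * Measurability and covers of exceptional sets *)

Lemma measurable_concave_on {R : realType} (J : set (measurableTypeR R))
    (phi : R -> R) :
  is_interval J -> concave_on J phi -> measurable_fun J phi.
Proof.
move=> iJ cphi mJ; apply: (measurability _ (RGenCInfty.measurableE R)) => //=.
move=> _ [_] [r] -> <-; rewrite (_ : _ `&` _ = [set x | J x /\ r <= phi x]).
  by apply: is_interval_measurable; apply: superlevel_le_is_interval.
by apply/seteqP; split=> x [Jx] /=; rewrite in_itv /= andbT.
Qed.

Lemma measurable_bool_natr {d} {T : measurableType d} {R : realType}
    (D : set T) (b : T -> bool) :
  measurable (D `&` [set x | b x]) -> measurable_fun D (fun x => (b x)%:R : R).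
Proof.
move=> mb; apply: (eq_measurable_fun (\1_(D `&` [set x | b x]) : T -> R)).
  move=> x /set_mem Dx; rewrite indicE; case: (boolP (b x)) => bx.
    by rewrite mem_set.
  by rewrite memNset // => -[_] /=; apply/negP.
exact: measurable_indic.
Qed.

Lemma finite_cover {R : realType} (I : finType) (c : R) (Q : I -> R -> Prop) :
  (forall i, exists B : set (measurableTypeR R), [/\ measurable B,
    (lebesgue_measure B <= c%:E)%E &
    forall x, Q i x -> B x]) ->
  exists B : set (measurableTypeR R), [/\ measurable B,
    (lebesgue_measure B <= (#|I|%:R * c)%:E)%E & forall i x, Q i x -> B x].
Proof.
move=> /choice[F hF].
have [B [mB lB hB]] : exists B : set (measurableTypeR R), [/\ measurable B,
    (lebesgue_measure B <= ((size (enum I))%:R * c)%:E)%E &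
    forall i x, i \in enum I -> Q i x -> B x].
  elim: (enum I) => [|i s [B [mB lB hB]]].
    by exists set0; split=> //; rewrite measure0 mul0r.
  have [mF lF hFi] := hF i.
  exists (F i `|` B); split; first exact: measurableU.
    apply: (le_trans (measureU2 _ _ _)) => //.
    apply: (le_trans (leeD lF lB)); rewrite -EFinD lee_fin /=.
    by rewrite -natr1; lra.
  move=> j x; rewrite inE => /orP[/eqP-> Qx|js Qx]; first by left; apply: hFi.
  by right; apply: hB Qx.
exists B; split=> //; first by rewrite cardE.
by move=> i x; apply: hB; rewrite mem_enum.
Qed.

(** Lets [finite_cover] range over all indices although a cover is available only for those
    satisfying [P]; the others receive the empty set. *)
Lemma optional_cover {R : realType} (P : Prop) (c : R) (Q : R -> Prop) :
  0 <= c ->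
  (P -> exists B : set (measurableTypeR R), [/\ measurable B,
    (lebesgue_measure B <= c%:E)%E &
    forall x, Q x -> B x]) ->
  exists B : set (measurableTypeR R), [/\ measurable B,
    (lebesgue_measure B <= c%:E)%E & forall x, P /\ Q x -> B x].
Proof.
move=> c0 h; have [p|np] := pselect P.
  by have [B [mB lB hB]] := h p; exists B; split=> // x [_]; apply: hB.
by exists set0; split=> //; [rewrite measure0 lee_fin|move=> x []].
Qed.

(** * Price vectors and the maximum norm *)

Section Prices.
Context {R : realType} {m : nat}.
Implicit Types (p z : 'cV[R]_m).

Lemma priceD p z i : price (p + z) i = price p i + price z i.
Proof. by rewrite /price; case: unlift => [j|]; rewrite ?mxE ?addr0. Qed.

Lemma priceZ (a : R) z i : price (a *: z) i = a * price z i.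
Proof. by rewrite /price; case: unlift => [j|]; rewrite ?mxE ?mulr0. Qed.

Lemma price_norm z i : `|price z i| <= `|z|.
Proof.
rewrite /price; case: unlift => [j|]; last by rewrite normr0.
rewrite [leRHS]/Num.norm /= mx_normrE; apply/bigmax_geP; right => /=.
by exists (j, 0).
Qed.

(** If the column has no entries, its norm is 0 and the fixed first price attains it. *)
Lemma price_norm_attained z : exists i, `|price z i| = `|z|.
Proof.
suff [i hi] : exists i, `|z| <= `|price z i|.
  by exists i; apply/le_anti; rewrite hi price_norm.
have := lexx `|z|; rewrite [X in _ <= X]/Num.norm /= mx_normrE.
case/bigmax_geP => [h|[[j k] _ /= h]]; first by exists ord0; apply: le_trans h _.
by exists (lift ord0 j); rewrite /price liftK -(ord1 k).
Qed.

Lemma price_ord0 z : price z ord0 = 0.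
Proof. by rewrite /price unlift_none. Qed.

Lemma price_lift z j : price z (lift ord0 j) = z j 0.
Proof. by rewrite /price liftK. Qed.

End Prices.

(** * Slices of the cells *)

Section CellGeometry.
Context {R : realType} {m : nat}.
Variables (Omega : set (R * R)) (y : 'I_m.+1 -> R * R) (J : set (measurableTypeR R))
  (g h : R -> R).
Hypothesis iJ : is_interval J.
Hypothesis cg : concave_on J g.
Hypothesis ch : concave_on J h.
Hypothesis OmegaE : Omega = [set x : R * R | J x.1 /\ - h x.1 <= x.2 <= g x.1].
Hypothesis y_distinct : forall i j : 'I_m.+1, i != j -> (y i).2 != (y j).2.
Implicit Types (p z : 'cV[R]_m) (e s : R) (i j k : 'I_m.+1).

Notation RT := (measurableTypeR R).
Notation lam := (@lebesgue_measure R).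
Notation mu2 := (lam \x lam)%E.

(* The points where the net costs of [i] and [j] agree form the graph of
   [tie p e i j]. *)
Definition tie p e i j (x1 : R) : R :=
  (e * ((y i).1 ^+ 2 - (y j).1 ^+ 2) + ((y i).2 ^+ 2 - (y j).2 ^+ 2)
    - (price p i - price p j) - 2 * e * x1 * ((y i).1 - (y j).1))
  / (2 * ((y i).2 - (y j).2)).

(** [tie] is affine in [(p, e)] jointly, so this is its exact change, linear in [(z, s)]. *)
Definition dtie z s i j (x1 : R) : R :=
  (s * ((y i).1 ^+ 2 - (y j).1 ^+ 2)
    - (price z i - price z j) - 2 * s * x1 * ((y i).1 - (y j).1))
  / (2 * ((y i).2 - (y j).2)).

Definition above i : pred 'I_m.+1 := [pred j | (y i).2 < (y j).2].
Definition below i : pred 'I_m.+1 := [pred j | (y j).2 < (y i).2].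

Lemma tieD p z e s i j x1 :
  tie (p + z) (e + s) i j x1 = tie p e i j x1 + dtie z s i j x1.
Proof. by rewrite /tie /dtie !priceD; ring. Qed.

Lemma tieC p e i j x1 : tie p e i j x1 = tie p e j i x1.
Proof.
rewrite /tie -[RHS]mulrNN -invrN; congr (_ / _); last by ring.
by ring.
Qed.

Lemma dtieD z z' s s' i j x1 :
  dtie (z + z') (s + s') i j x1 = dtie z s i j x1 + dtie z' s' i j x1.
Proof. by rewrite /dtie !priceD; ring. Qed.

Lemma dtieZ a z s i j x1 : dtie (a *: z) (a * s) i j x1 = a * dtie z s i j x1.
Proof. by rewrite /dtie !priceZ; ring. Qed.

Lemma tie_affine p e i j : exists a b, tie p e i j = fun x1 => a + b * x1.
Proof.
exists (tie p e i j 0).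
exists (- (2 * e * ((y i).1 - (y j).1)) / (2 * ((y i).2 - (y j).2))).
by apply/funext => x1; rewrite /tie; ring.
Qed.

Lemma dtie_affine z s i j : exists a b, dtie z s i j = fun x1 => a + b * x1.
Proof.
exists (dtie z s i j 0).
exists (- (2 * s * ((y i).1 - (y j).1)) / (2 * ((y i).2 - (y j).2))).
by apply/funext => x1; rewrite /dtie; ring.
Qed.

Lemma Y_neq i j : i != j -> (y i).2 - (y j).2 != 0.
Proof. by rewrite subr_eq0; apply: y_distinct. Qed.

(** The squares of the coordinates of [x] cancel, which leaves a comparison affine in [x.2]; the
    order of the second coordinates decides its direction. *)
Lemma net_cost_tie p e (x : R * R) i j : i != j ->
  net_cost y p e x i - net_cost y p e x j =
  2 * ((y j).2 - (y i).2) * (x.2 - tie p e i j x.1).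
Proof.
move=> /Y_neq ij; rewrite /net_cost /cost /tie; field.
by rewrite ij.
Qed.

Lemma net_cost_le p e (x : R * R) i j :
  (net_cost y p e x i <= net_cost y p e x j) =
  (above i j ==> (x.2 <= tie p e i j x.1)) &&
  (below i j ==> (tie p e i j x.1 <= x.2)).
Proof.
rewrite /above /below /=; have [->|ij] := eqVneq i j; first by rewrite lexx ltxx.
rewrite -subr_le0 net_cost_tie //; have := y_distinct ij; rewrite neq_lt.
case: (ltgtP (y i).2 (y j).2) => //= c _.
  by rewrite andbT pmulr_rle0 ?subr_le0 //; lra.
by rewrite nmulr_rle0 ?subr_ge0 //; lra.
Qed.

Lemma min_net_costP p e x i :
  min_net_cost y p e x = net_cost y p e x i <->
  forall j, net_cost y p e x i <= net_cost y p e x j.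
Proof.
rewrite /min_net_cost; split=> [<- j|hi]; first exact: bigmin_le_cond.
apply/le_anti/andP; split; first exact: bigmin_le_cond.
by apply/(le_bminP predT (net_cost y p e x ord0) (net_cost y p e x)); split.
Qed.

Definition top p e i x1 := bmin (above i) (g x1) (fun j => tie p e i j x1).
Definition bot p e i x1 :=
  bmin (below i) (h x1) (opps (fun j => tie p e i j x1)).

(** Each competitor bounds [x.2] from one side, according to the order of the second coordinates.
    Hence a vertical section of a cell is a segment. *)
Lemma cellE p e i x : cell Omega y p e i x <->
  J x.1 /\ - bot p e i x.1 <= x.2 <= top p e i x.1.
Proof.
rewrite /cell /= min_net_costP OmegaE /= !(lerNl _ x.2); split.
  move=> [[Jx /andP[hx gx]] hn]; split=> //; apply/andP; split.
    apply/le_bminP; split=> //.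
    by move=> j bj; have := hn j; rewrite net_cost_le bj /opps lerN2 => /andP[].
  apply/le_bminP; split=> // j aj.
  by have := hn j; rewrite net_cost_le aj => /andP[].
move=> [Jx /andP[/le_bminP[h1 h2] /le_bminP[h3 h4]]]; split.
  by split=> //; rewrite h3 andbT.
move=> j; rewrite net_cost_le; apply/andP; split; apply/implyP => hj; first exact: h4.
by have := h2 j hj; rewrite /opps lerN2.
Qed.

Definition slice_len p e i x1 :=
  len (above i) (below i) (g x1) (h x1) (fun j => tie p e i j x1).

Lemma slice_gapE p e i x1 :
  gap (above i) (below i) (g x1) (h x1) (fun j => tie p e i j x1) =
  top p e i x1 + bot p e i x1.
Proof. by []. Qed.

Lemma concave_tie p e i j : concave_on J (tie p e i j).
Proof. by have [a [b ->]] := tie_affine p e i j; apply: concave_on_affine. Qed.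

Lemma concave_oppr_tie p e i j : concave_on J (fun x => - tie p e i j x).
Proof.
have [a [b ->]] := tie_affine p e i j.
rewrite (_ : (fun _ => _) = (fun x => - a + (- b) * x)); last first.
  by apply/funext => x; ring.
exact: concave_on_affine.
Qed.

Lemma concave_top p e i : concave_on J (top p e i).
Proof. by apply: concave_on_bmin => // j _; apply: concave_tie. Qed.

Lemma concave_bot p e i : concave_on J (bot p e i).
Proof. by apply: concave_on_bmin => // j _; apply: concave_oppr_tie. Qed.

(** This is the slice length before truncation at 0; its concavity limits the set where it is nearly
    0. *)
Lemma concave_gap p e i : concave_on J (fun x => top p e i x + bot p e i x).
Proof. by apply: concave_onD; [apply: concave_top|apply: concave_bot]. Qed.

Lemma measurable_J : measurable J.
Proof. exact: is_interval_measurable. Qed.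

Lemma measurable_between (b t : R -> R) :
  measurable_fun J b -> measurable_fun J t ->
  measurable [set x : RT * RT | J x.1 /\ - b x.1 <= x.2 <= t x.1].
Proof.
move=> mb mt; have mJ := measurable_J.
have mJT : measurable (J `*` [set: RT]) by apply: measurableX.
have m1 (u : R -> R) : measurable_fun J u ->
    measurable_fun (J `*` [set: RT]) (fun x : RT * RT => u x.1).
  move=> mu; apply: (measurable_comp mJ _ mu).
    by move=> _ [x [Jx _]] <-.
  exact: measurable_funTS.
have mA1 : measurable ((J `*` [set: RT]) `&` [set x | - b x.1 <= x.2]).
  have := @measurable_fun_ler _ _ R (J `*` [set: RT]) (fun x => - b x.1) snd.
  move=> /(_ _ _ mJT [set true]) h0.
  rewrite (_ : _ `&` _ = (J `*` [set: RT]) `&`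
    (fun x : RT * RT => - b x.1 <= x.2) @^-1` [set true]).
    apply: h0 => //; last exact: measurable_funTS.
    by apply: measurableT_comp => //; apply: m1.
  by [].
have mA2 : measurable ((J `*` [set: RT]) `&` [set x | x.2 <= t x.1]).
  have := @measurable_fun_ler _ _ R (J `*` [set: RT]) snd (fun x => t x.1).
  move=> /(_ _ _ mJT [set true]) h0.
  rewrite (_ : _ `&` _ = (J `*` [set: RT]) `&`
    (fun x : RT * RT => x.2 <= t x.1) @^-1` [set true]).
    apply: h0 => //; first exact: measurable_funTS.
    exact: m1.
  by [].
rewrite (_ : [set _ | _] = ((J `*` [set: RT]) `&` [set x | - b x.1 <= x.2]) `&`
  ((J `*` [set: RT]) `&` [set x | x.2 <= t x.1])); first exact: measurableI.
apply/seteqP; split=> x /=; first by move=> [Jx /andP[]].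
by move=> [[[Jx _] ->] [_ ->]].
Qed.

Lemma measurable_Omega : measurable (Omega : set (RT * RT)).
Proof. by rewrite OmegaE; apply: measurable_between; apply: measurable_concave_on. Qed.

Lemma measurable_cell p e i : measurable (cell Omega y p e i : set (RT * RT)).
Proof.
rewrite (_ : cell _ _ _ _ _ = [set x | J x.1 /\ - bot p e i x.1 <= x.2 <= top p e i x.1]).
  apply: measurable_between; apply: measurable_concave_on => //.
    exact: concave_bot.
  exact: concave_top.
by apply/seteqP; split=> x; rewrite cellE.
Qed.

Lemma area_cell p e i :
  area (cell Omega y p e i) = (\int[lam]_(x in J) (slice_len p e i x)%:E)%E.
Proof.
rewrite /area /product_measure1 [RHS]integral_mkcond.
apply: eq_integral => x _; rewrite patchE /=.
case: ifPn => [/set_mem Jx|/negP nJ].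
  rewrite (_ : xsection _ _ = `[- bot p e i x, top p e i x]%classic); last first.
    apply/seteqP; split=> t; rewrite /= xsectionP cellE /= in_itv /=.
      by case.
    by [].
  rewrite lebesgue_measure_itv /= lte_fin /slice_len /len slice_gapE.
  by rewrite -subr_gt0 opprK; case: ltP.
rewrite (_ : xsection _ _ = set0) ?measure0 //.
apply/seteqP; split=> // t; rewrite xsectionP cellE /= => -[Jx _].
by apply: nJ; apply: mem_set.
Qed.


(** * Uniform bounds and the first variation of the areas *)

Variable D : R.
Hypothesis D_gt0 : 0 < D.
Hypothesis JD : forall x, J x -> - D <= x <= D.
Hypothesis gD : forall x, J x -> g x <= D.
Hypothesis hD : forall x, J x -> h x <= D.
Hypothesis yD : forall i, `|(y i).1| <= D /\ `|(y i).2| <= D.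

Definition ar p e i : R := fine (area (cell Omega y p e i)).

Lemma slice_len_ge0 p e i x : 0 <= slice_len p e i x.
Proof. by rewrite le_max lexx. Qed.

Lemma slice_len_le p e i x : J x -> slice_len p e i x <= 2 * D.
Proof.
move=> Jx; rewrite /slice_len /len slice_gapE ge_max; apply/andP; split.
  by rewrite mulr_ge0 // ltW.
have := bmin_le_id (above i) (g x) (fun j => tie p e i j x).
have := bmin_le_id (below i) (h x) (opps (fun j => tie p e i j x)).
by have := gD Jx; have := hD Jx; rewrite /top /bot; lra.
Qed.

Lemma lebesgue_J : (lam J <= (2 * D)%:E)%E.
Proof.
have -> : (2 * D)%:E = lam `[- D, D]%classic.
  have DD : - D < D by have := D_gt0; lra.
  by rewrite lebesgue_measure_itv /= lte_fin DD -EFinB; congr EFin; ring.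
apply: le_measure; rewrite ?inE //; first exact: measurable_J.
Qed.

Lemma integrable_J (u : R -> R) (M : R) : measurable_fun J u ->
  (forall x, J x -> `|u x| <= M) -> lam.-integrable J (EFin \o u).
Proof.
move=> mu uM; apply: measurable_bounded_integrable => //.
- exact: measurable_J.
- exact: le_lt_trans lebesgue_J (ltry _).
- exists M; split; first exact: num_real.
  by move=> t Mt x Jx; apply: le_trans (uM x Jx) (ltW Mt).
Qed.

(** When the integrand and the length of the set carrying it are both of order [r], the integral is
    of order [r ^+ 2]. *)
Lemma Rintegral_J_cover (u : R -> R) (B : set RT) (M b : R) :
  measurable_fun J u -> measurable B -> (lam B <= b%:E)%E -> 0 <= M ->
  (forall x, J x -> `|u x| <= M) -> (forall x, J x -> ~ B x -> u x = 0) ->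
  `|\int[lam]_(x in J) u x| <= M * b.
Proof.
move=> mu mB lB M0 uM uB; have mJ := measurable_J.
have iu := integrable_J mu uM.
have i1 : lam.-integrable J (EFin \o \1_B).
  apply: (@integrable_J _ 1); first exact: measurable_indic.
  by move=> x _; rewrite indicE; case: (_ \in _); rewrite ?normr1 ?normr0.
apply: (le_trans (le_normr_Rintegral mJ iu)).
apply: (@le_trans _ _ (\int[lam]_(x in J) (M * \1_B x))).
  apply: le_Rintegral => //; first exact: (integrable_norm iu).
    apply: (@integrable_J _ M).
      by apply: measurable_funM => //; exact: measurable_indic.
    move=> x _; rewrite indicE; case: (_ \in _); rewrite ?mulr1 ?mulr0 ?normr0 //.
    by rewrite ger0_norm.
  move=> x Jx; rewrite indicE; case: (pselect (B x)) => Bx.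
    by rewrite mem_set // mulr1; apply: uM.
  by rewrite (uB x Jx Bx) memNset // mulr0 normr0.
rewrite RintegralZl //; apply: ler_wpM2l => //.
rewrite /Rintegral /= integral_indic // -lee_fin.
have lBJ : (lam (B `&` J) <= b%:E)%E.
  by apply: le_trans lB; apply: le_measure; rewrite ?inE //; exact: measurableI.
by rewrite fineK // ge0_fin_numE //; apply: le_lt_trans lBJ (ltry _).
Qed.

Lemma Rintegral_J_bound (u : R -> R) (M : R) : measurable_fun J u ->
  0 <= M -> (forall x, J x -> `|u x| <= M) ->
  `|\int[lam]_(x in J) u x| <= M * (2 * D).
Proof.
move=> mu M0 uM; apply: (Rintegral_J_cover mu measurable_J lebesgue_J) => //.
Qed.

Lemma measurable_slice_len p e i : measurable_fun J (slice_len p e i).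
Proof.
apply: measurable_maxr; first exact: measurable_cst.
by apply: measurable_concave_on => //; exact: concave_gap.
Qed.

Lemma integrable_slice_len p e i :
  lam.-integrable J (EFin \o slice_len p e i).
Proof.
apply: (@integrable_J _ (2 * D)); first exact: measurable_slice_len.
by move=> x Jx; rewrite ger0_norm ?slice_len_ge0 // slice_len_le.
Qed.

Lemma arE p e i : ar p e i = \int[lam]_(x in J) slice_len p e i x.
Proof. by rewrite /ar area_cell. Qed.

Lemma areaE p e i : area (cell Omega y p e i) = (ar p e i)%:E.
Proof.
rewrite /ar fineK // area_cell; apply: integrable_fin_num.
  exact: measurable_J.
exact: integrable_slice_len.
Qed.

(** The neutral value [2 * D] covers the case of a single point and yields [Ygap_le_D]. *)
Definition Ygap : R := bmin [pred ij | ij.1 != ij.2] (2 * D)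
  (fun ij : 'I_m.+1 * 'I_m.+1 => `|(y ij.1).2 - (y ij.2).2|).

Lemma Ygap_gt0 : 0 < Ygap.
Proof.
rewrite /Ygap; have [->|[[i j] /= ij ->]] := bmin_attained
  [pred ij : 'I_m.+1 * 'I_m.+1 | ij.1 != ij.2] (2 * D)
  (fun ij => `|(y ij.1).2 - (y ij.2).2|).
  by rewrite mulr_gt0.
by rewrite normr_gt0 Y_neq.
Qed.

Lemma Ygap_le i j : i != j -> Ygap <= `|(y i).2 - (y j).2|.
Proof. by move=> ij; apply: (bmin_le _ _ (j := (i, j))). Qed.

Lemma Ygap_le_D : Ygap <= 2 * D.
Proof. exact: bmin_le_id. Qed.

(** In the numerator, [2 * D ^+ 2] comes from the squares, [4 * D ^+ 2] from the term in [x1], and 2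
    from the two prices. *)
Definition tie_lip : R := (6 * D ^+ 2 + 2) / (2 * Ygap).

Lemma tie_lip_gt0 : 0 < tie_lip.
Proof.
have := Ygap_gt0 => g0; apply: divr_gt0; last by lra.
by have := sqr_ge0 D; lra.
Qed.

Lemma dtie_bound z s i j x : J x -> `|dtie z s i j x| <= tie_lip * (`|z| + `|s|).
Proof.
move=> Jx; have nz : 0 <= `|z| + `|s| by rewrite addr_ge0.
(* For [i = j] the denominator is 0, and its inverse is 0 by convention. *)
have [->|ij] := eqVneq i j.
  by rewrite /dtie !subrr !mulr0 invr0 mulr0 normr0 mulr_ge0 // ltW // tie_lip_gt0.
have gij := Ygap_le ij; have g0 := Ygap_gt0.
rewrite /dtie normrM normfV [`|2 * _|]normrM (ger0_norm (ler0n _ 2)).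
rewrite /tie_lip [leRHS]mulrAC.
apply: ler_pM => //; last by rewrite lef_pV2 ?posrE; lra.
have pzi := price_norm z i; have pzj := price_norm z j.
have [xi _] := yD i; have [xj _] := yD j.
have xD : `|x| <= D by rewrite ler_norml JD.
have sq : `|(y i).1 ^+ 2 - (y j).1 ^+ 2| <= 2 * D ^+ 2.
  apply: le_trans (ler_normB _ _) _; rewrite !normrX.
  by have := normr_ge0 (y i).1; have := normr_ge0 (y j).1; nra.
have df : `|(y i).1 - (y j).1| <= 2 * D.
  by apply: le_trans (ler_normB _ _) _; lra.
apply: (@le_trans _ _ (`|s| * (2 * D ^+ 2) + 2 * `|z| + 2 * `|s| * D * (2 * D))).
  apply: le_trans (ler_normB _ _) _; apply: lerD.
    apply: le_trans (ler_normB _ _) _; apply: lerD.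
      by rewrite normrM; apply: ler_wpM2l.
    by apply: le_trans (ler_normB _ _) _; lra.
  rewrite !normrM (ger0_norm (ler0n _ 2)).
  by apply: ler_pM => //; apply: ler_wpM2l => //; rewrite mulr_ge0.
have : 0 <= `|z| * D ^+ 2 by rewrite mulr_ge0 // sqr_ge0.
by have := normr_ge0 s; lra.
Qed.

Lemma slice_lenD p z e s i x : slice_len (p + z) (e + s) i x =
  len (above i) (below i) (g x) (h x)
    (fun j => tie p e i j x + dtie z s i j x).
Proof.
by rewrite /slice_len; congr len; apply/funext => j; rewrite tieD.
Qed.

Lemma ar_lip p z e s i :
  `|ar (p + z) (e + s) i - ar p e i| <= 4 * D * tie_lip * (`|z| + `|s|).
Proof.
have t0 := tie_lip_gt0; have nz : 0 <= `|z| + `|s| by rewrite addr_ge0.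
rewrite !arE -RintegralB //; [|exact: measurable_J|exact: integrable_slice_len..].
have -> : 4 * D * tie_lip * (`|z| + `|s|) =
  2 * (tie_lip * (`|z| + `|s|)) * (2 * D) by ring.
apply: Rintegral_J_bound.
- by apply: measurable_funB; exact: measurable_slice_len.
- by apply: mulr_ge0 => //; apply: mulr_ge0 => //; exact: ltW.
move=> x Jx; rewrite slice_lenD; apply: len_lip; first by rewrite mulr_ge0 // ltW.
by move=> j; apply: dtie_bound.
Qed.

Definition slice_dlen p e z s i x : R :=
  dlen (above i) (below i) (g x) (h x) (fun j => tie p e i j x)
    (fun j => dtie z s i j x).

(** The coefficients of the [dtie] do not depend on the direction. This gives linearity in [(z, s)]
    and reduces measurability to that of indicators. *)
Lemma slice_dlenE p e z s i x : slice_dlen p e z s i x =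
  \sum_j (0 < top p e i x + bot p e i x)%R%:R *
    ((strict_min (above i) (g x) (fun k => tie p e i k x) j)%:R -
     (strict_min (below i) (h x) (opps (fun k => tie p e i k x)) j)%:R) *
    dtie z s i j x.
Proof.
rewrite /slice_dlen /dlen slice_gapE /dbmin -big_split /= mulr_sumr.
by apply: eq_bigr => j _; rewrite /opps; ring.
Qed.

Lemma slice_dlenD p e z z' s s' i x : slice_dlen p e (z + z') (s + s') i x =
  slice_dlen p e z s i x + slice_dlen p e z' s' i x.
Proof.
by rewrite !slice_dlenE -big_split; apply: eq_bigr => j _; rewrite dtieD mulrDr.
Qed.

Lemma slice_dlenZ p e a z s i x : slice_dlen p e (a *: z) (a * s) i x =
  a * slice_dlen p e z s i x.
Proof.
by rewrite !slice_dlenE mulr_sumr; apply: eq_bigr => j _; rewrite dtieZ mulrCA.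
Qed.

(** Being the strict minimizer means that several concave functions are positive, which happens on
    an interval. *)
Lemma measurable_strict_min (P : pred 'I_m.+1) (u : R -> R)
    (L : 'I_m.+1 -> R -> R) j : concave_on J u ->
  (forall k, exists a b, L k = fun x => a + b * x) ->
  measurable_fun J (fun x => (strict_min P (u x) (fun k => L k x) j)%:R : R).
Proof.
move=> cu aL; apply: measurable_bool_natr.
have cL k k' : concave_on J (fun x => L k x - L k' x).
  have [a [b ->]] := aL k; have [a' [b' ->]] := aL k'.
  rewrite (_ : (fun _ => _) = (fun x => (a - a') + (b - b') * x)).
    exact: concave_on_affine.
  by apply/funext => x; ring.
have cu' k : concave_on J (fun x => u x - L k x).
  have [a [b ->]] := aL k.
  rewrite (_ : (fun _ => _) = (fun x => u x + (- a + (- b) * x))).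
    by apply: concave_onD => //; exact: concave_on_affine.
  by apply/funext => x; ring.
apply: is_interval_measurable => s t [Js /strict_minP[Pj sg sL]]
  [Jt /strict_minP[_ tg tL]] x sxt.
have sup phi : concave_on J phi -> 0 < phi s -> 0 < phi t -> 0 < phi x.
  move=> cphi ps pt.
  by have [] := @superlevel_lt_is_interval _ J phi 0 iJ cphi s t (conj Js ps)
    (conj Jt pt) x sxt.
split; first exact: iJ Js Jt x sxt.
apply/strict_minP; split=> // [|k Pk kj]; rewrite -subr_gt0.
  by apply: (sup _ (cu' j)); rewrite subr_gt0.
by apply: (sup _ (cL k j)); rewrite subr_gt0; [apply: sL|apply: tL].
Qed.

Lemma measurable_slice_dlen p e z s i :
  measurable_fun J (slice_dlen p e z s i).
Proof.
rewrite (_ : slice_dlen _ _ _ _ _ = (fun x => slice_dlen p e z s i x)) //.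
under eq_fun do rewrite slice_dlenE.
apply: measurable_sum => j; apply: measurable_funM; first apply: measurable_funM.
- apply: measurable_bool_natr; apply: is_interval_measurable.
  by apply: (superlevel_lt_is_interval (c := 0)) => //; apply: concave_gap.
- apply: measurable_funB; apply: measurable_strict_min => // k.
    exact: tie_affine.
  have [a [b E]] := tie_affine p e i k; exists (- a), (- b).
  by apply/funext => x; rewrite /opps E; ring.
- have [a [b ->]] := dtie_affine z s i j.
  by apply: measurable_concave_on => //; exact: concave_on_affine.
Qed.

Lemma slice_dlen_bound p e z s i x : J x -> `|slice_dlen p e z s i x| <=
  (2 * #|'I_m.+1|%:R) * (tie_lip * (`|z| + `|s|)).
Proof. by move=> Jx; apply: dlen_bound => j; apply: dtie_bound. Qed.

Lemma integrable_slice_dlen p e z s i :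
  lam.-integrable J (EFin \o slice_dlen p e z s i).
Proof.
apply: integrable_J; first exact: measurable_slice_dlen.
by move=> x; apply: slice_dlen_bound.
Qed.

(** The candidate for the derivative of the area at [(p, e)] in the direction [(z, s)]; [ar_taylor]
    confirms it when all areas are bounded below. *)
Definition dar p e z s i : R := \int[lam]_(x in J) slice_dlen p e z s i x.

Lemma darD p e z z' s s' i :
  dar p e (z + z') (s + s') i = dar p e z s i + dar p e z' s' i.
Proof.
rewrite /dar -RintegralD; [|exact: measurable_J|exact: integrable_slice_dlen..].
by apply: eq_Rintegral => x _; rewrite slice_dlenD.
Qed.

Lemma darZ p e a z s i : dar p e (a *: z) (a * s) i = a * dar p e z s i.
Proof.
rewrite /dar -RintegralZl; [|exact: measurable_J|exact: integrable_slice_dlen].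
by apply: eq_Rintegral => x _; rewrite slice_dlenZ.
Qed.

Definition dar_lip : R := 4 * D * #|'I_m.+1|%:R * tie_lip.

Lemma dar_bound p e z s i : `|dar p e z s i| <= dar_lip * (`|z| + `|s|).
Proof.
have t0 := tie_lip_gt0; have nz : 0 <= `|z| + `|s| by rewrite addr_ge0.
rewrite /dar_lip (_ : 4 * D * _ * _ * _ = (2 * #|'I_m.+1|%:R) *
  (tie_lip * (`|z| + `|s|)) * (2 * D)); last by ring.
apply: Rintegral_J_bound; first exact: measurable_slice_dlen.
  by rewrite mulr_ge0 // mulr_ge0 // ltW.
by move=> x; apply: slice_dlen_bound.
Qed.

(** * Taylor expansion of the areas *)

(** Otherwise every slice is shorter than [eta / (4 * D)], and over a base of length at most [2 * D]
    the area is at most [eta / 2]. *)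
Lemma thick_slice p e i eta : 0 < eta -> eta <= ar p e i ->
  exists2 x, J x & eta / (4 * D) <= top p e i x + bot p e i x.
Proof.
move=> eta0 hi; have D0 := D_gt0; apply: contrapT => hn.
have k0 : 0 < eta / (4 * D) by rewrite divr_gt0 //; lra.
have thin x : J x -> `|slice_len p e i x| <= eta / (4 * D).
  move=> Jx; rewrite ger0_norm ?slice_len_ge0 // /slice_len /len slice_gapE.
  rewrite ge_max (ltW k0) /= leNgt; apply/negP => h1.
  by apply: hn; exists x => //; apply: ltW.
have := Rintegral_J_bound (measurable_slice_len p e i) (ltW k0) thin.
rewrite -arE => h1; have := le_trans hi (le_trans (ler_norm _) h1).
have -> : eta / (4 * D) * (2 * D) = eta / 2 by field; lra.
by lra.
Qed.

(** Net cost differences add up along [i], [j], [k]. If [j] is the middle point, the interface of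
    [i] and [k] is a weighted mean of the other two. *)
Lemma tie_chain p e i j k x : i != j -> j != k -> i != k ->
  ((y j).2 - (y i).2) * tie p e i j x + ((y k).2 - (y j).2) * tie p e j k x
  = ((y k).2 - (y i).2) * tie p e i k x.
Proof.
move=> /Y_neq ij /Y_neq jk /Y_neq ik; rewrite /tie; field.
by rewrite ij jk ik.
Qed.

(** The thickness from [thick_slice] times a lower bound for the weights in the mean of
    [tie_chain]. *)
Definition tie_gap eta : R := eta / (4 * D) * (Ygap / (2 * D)).

Lemma tie_gap_gt0 eta : 0 < eta -> 0 < tie_gap eta.
Proof.
move=> eta0; have := D_gt0; have := Ygap_gt0 => Y0 D0.
by apply: mulr_gt0; apply: divr_gt0 => //; lra.
Qed.

Lemma tie_gap_le eta : 0 < eta -> tie_gap eta <= eta / (4 * D).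
Proof.
move=> eta0; have := D_gt0 => D0; rewrite /tie_gap -[leRHS]mulr1.
apply: ler_wpM2l; first by rewrite divr_ge0 //; lra.
by rewrite ler_pdivrMr ?mul1r ?Ygap_le_D //; lra.
Qed.

Lemma above_neq i j : above i j -> i != j.
Proof. by rewrite /above /= => lt; apply: contraTneq lt => ->; rewrite ltxx. Qed.

Lemma Ygap_ratio a b : Ygap <= a -> 0 < b -> b <= 2 * D ->
  Ygap / (2 * D) <= a / b.
Proof.
move=> Ya b0 bD; have Y0 := Ygap_gt0; have D0 := D_gt0.
by apply: ler_pM => //;
  [exact: ltW|rewrite invr_ge0; lra|rewrite lef_pV2 ?posrE //; lra].
Qed.

Lemma Ygap_lt i j : (y i).2 < (y j).2 ->
  Ygap <= (y j).2 - (y i).2 /\ (y j).2 - (y i).2 <= 2 * D.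
Proof.
move=> ij; split.
  by rewrite -[leRHS]gtr0_norm ?subr_gt0 // Ygap_le // eq_sym (above_neq (i := i)).
have [_] := yD i; have [_] := yD j.
by rewrite !ler_norml => /andP[? ?] /andP[? ?]; lra.
Qed.

Definition band_lip eta : R := 16 * D / tie_gap eta.

Lemma band_lip_gt0 eta : 0 < eta -> 0 < band_lip eta.
Proof.
by move=> eta0; have D0 := D_gt0; rewrite divr_gt0 ?tie_gap_gt0 //; lra.
Qed.

(** Counts the sets united in [tie_cover]: one for a vanishing slice, two families for competitors
    against the boundary of the polygon, two for pairs of competitors. *)
Definition tie_cover_lip eta : R :=
  (1 + 2 * #|'I_m.+1|%:R + 2 * #|{: 'I_m.+1 * 'I_m.+1}|%:R) * band_lip eta.

(** The pointwise error from [len_taylor] times the measure of the set from [tie_cover], each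
    divided by the size of the increment. *)
Definition taylor_const eta : R :=
  (2 + 2 * #|'I_m.+1|%:R) * tie_lip * (2 * tie_cover_lip eta * tie_lip).

Lemma taylor_const_ge0 eta : 0 < eta -> 0 <= taylor_const eta.
Proof.
move=> eta0; have t0 := ltW tie_lip_gt0.
rewrite /taylor_const /tie_cover_lip; apply: mulr_ge0; first exact: mulr_ge0.
apply: mulr_ge0 => //; apply: mulr_ge0 => //; apply: mulr_ge0.
  by rewrite !addr_ge0 // mulr_ge0.
exact: ltW (band_lip_gt0 eta0).
Qed.

Section Nondegenerate.
Variables (p : 'cV[R]_m) (e eta : R).
Hypothesis eta_gt0 : 0 < eta.
Hypothesis area_ge : forall j, eta <= ar p e j.

(** A thick slice of the cell of [j] fits between this interface and the upper boundary of the
    polygon. *)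
Lemma above_top_gap i j : above i j ->
  exists2 x, J x & tie_gap eta <= g x - tie p e i j x.
Proof.
move=> aij; have [x Jx hx] := thick_slice eta_gt0 (area_ge j).
exists x => //; apply: (le_trans (tie_gap_le eta_gt0)); apply: (le_trans hx).
have := bmin_le_id (above j) (g x) (fun k => tie p e j k x).
have := bmin_le (h x) (opps (fun k => tie p e j k x)) (aij : below j i).
by rewrite /top /bot /opps (tieC p e i j); lra.
Qed.

Lemma below_bot_gap i j : below i j ->
  exists2 x, J x & tie_gap eta <= h x + tie p e i j x.
Proof.
move=> bij; have [x Jx hx] := thick_slice eta_gt0 (area_ge j).
exists x => //; apply: (le_trans (tie_gap_le eta_gt0)); apply: (le_trans hx).
have := bmin_le_id (below j) (h x) (opps (fun k => tie p e j k x)).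
have := bmin_le (g x) (fun k => tie p e j k x) (bij : above j i).
by rewrite /top /bot (tieC p e i j); lra.
Qed.

(* If the [i]-[j] and [i]-[k] interfaces nearly coincided, the cell of the
   middle one of the three points would be squeezed between them. *)
Lemma middle_gap i j k : (y i).2 < (y j).2 -> (y j).2 < (y k).2 ->
  exists2 x, J x & eta / (4 * D) <= tie p e j k x - tie p e i j x.
Proof.
move=> aij ajk; have [x Jx hx] := thick_slice eta_gt0 (area_ge j).
exists x => //; apply: (le_trans hx).
have := bmin_le (h x) (opps (fun k => tie p e j k x)) (aij : below j i).
have := bmin_le (g x) (fun k => tie p e j k x) (ajk : above j k).
by rewrite /top /bot /opps (tieC p e i j); lra.
Qed.

(** At a thick slice of the middle cell, the outer interface divides the gap between the other two
    in the ratio of the differences of second coordinates, so it stays away from both. *)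
Lemma chain_gap i j k : (y i).2 < (y j).2 -> (y j).2 < (y k).2 ->
  exists2 x, J x & tie_gap eta <= tie p e i k x - tie p e i j x /\
    tie_gap eta <= tie p e j k x - tie p e i k x.
Proof.
move=> ij jk; have [x Jx hx] := middle_gap ij jk; exists x => //.
have [ij1 ij2] := Ygap_lt ij; have [jk1 jk2] := Ygap_lt jk.
have [ik1 ik2] := Ygap_lt (lt_trans ij jk).
have Y0 := Ygap_gt0; have D0 := D_gt0.
have rel := tie_chain p e x (above_neq ij) (above_neq jk)
  (above_neq (lt_trans ij jk)).
set a := (y j).2 - (y i).2 in rel ij1 *; set b := (y k).2 - (y j).2 in rel jk1 *.
set c := (y k).2 - (y i).2 in rel ik2 ik1 *.
have cab : c = a + b by rewrite /a /b /c; ring.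
have c0 : c != 0 by lra.
set T1 := tie p e i j x in rel hx *; set T2 := tie p e j k x in rel hx *.
set T3 := tie p e i k x in rel *.
have eta0 := eta_gt0.
have E1 : T3 - T1 = (T2 - T1) * (b / c).
  by apply: (mulfI c0); rewrite mulrBr -rel cab; field; rewrite -cab.
have E2 : T2 - T3 = (T2 - T1) * (a / c).
  by apply: (mulfI c0); rewrite mulrBr -rel cab; field; rewrite -cab.
have cp : 0 < c by lra.
have k1 : 0 <= eta / (4 * D) by rewrite divr_ge0 ?mulr_ge0 // ltW.
have k2 : 0 <= Ygap / (2 * D) by rewrite divr_ge0 ?mulr_ge0 // ltW.
by rewrite E1 E2 /tie_gap; split; apply: ler_pM => //; exact: Ygap_ratio.
Qed.

(** Here [i] is the lowest of the three points, in [below_pair_gap] the highest; [chain_gap] serves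
    both. *)
Lemma above_pair_gap i j k : above i j -> above i k -> j != k ->
  exists2 x, J x & tie_gap eta <= `|tie p e i j x - tie p e i k x|.
Proof.
wlog jk : j k / (y j).2 < (y k).2 => [hw aj ak jk|aij _ _].
  have := y_distinct jk; rewrite neq_lt => /orP[lt|lt]; first exact: hw.
  by have [|x Jx hx] := hw k j lt ak aj; [rewrite eq_sym|exists x; rewrite // distrC].
have [x Jx [hx _]] := chain_gap aij jk; exists x => //.
by rewrite distrC; apply: le_trans hx (ler_norm _).
Qed.

Lemma below_pair_gap i j k : below i j -> below i k -> j != k ->
  exists2 x, J x & tie_gap eta <= `|tie p e i j x - tie p e i k x|.
Proof.
wlog jk : j k / (y k).2 < (y j).2 => [hw aj ak jk|bij _ _].
  have := y_distinct jk; rewrite neq_lt => /orP[lt|lt]; last exact: hw.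
  by have [|x Jx hx] := hw k j lt ak aj; [rewrite eq_sym|exists x; rewrite // distrC].
have [x Jx [_ hx]] := chain_gap jk bij; exists x => //.
by rewrite (tieC p e i j) (tieC p e i k); apply: le_trans hx (ler_norm _).
Qed.

Let concave_cover (phi : R -> R) r : 0 <= r -> concave_on J phi ->
  (exists2 x, J x & tie_gap eta <= phi x) ->
  exists B : set RT, [/\ measurable B, (lam B <= (band_lip eta * r)%:E)%E &
    forall x, J x /\ `|phi x| <= r -> B x].
Proof.
move=> r0 cphi [x Jx hx].
have [B [mB lB hB]] := concave_band_cover iJ cphi JD D_gt0 Jx (tie_gap_gt0 eta_gt0) hx r0.
by exists B; split=> // t []; apply: hB.
Qed.

Let tie_pair_cover i j k r : 0 <= r ->
  (exists2 x, J x & tie_gap eta <= `|tie p e i j x - tie p e i k x|) ->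
  exists B : set RT, [/\ measurable B, (lam B <= (band_lip eta * r)%:E)%E &
    forall x, J x /\ `|tie p e i j x - tie p e i k x| <= r -> B x].
Proof.
move=> r0; have [a [b ->]] := tie_affine p e i j; have [a' [b' ->]] := tie_affine p e i k.
have E t : a + b * t - (a' + b' * t) = (a - a') + (b - b') * t by ring.
move=> [x Jx]; rewrite E => hx.
have [B [mB lB hB]] := affine_band_cover iJ JD D_gt0 Jx (tie_gap_gt0 eta_gt0) hx r0.
by exists B; split=> // t [Jt]; rewrite E; apply: hB.
Qed.

(** Each failure places a concave or affine function in the band of half width [r]. That function
    reaches [tie_gap eta] in absolute value somewhere, so the failure set is short. *)
Lemma tie_cover i r : 0 <= r ->
  exists B : set RT, [/\ measurable B, (lam B <= (tie_cover_lip eta * r)%:E)%E &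
    forall x, J x -> ~ B x ->
    [/\ separated (above i) (g x) (fun j => tie p e i j x) r,
        separated (below i) (h x) (opps (fun j => tie p e i j x)) r &
        r < `|gap (above i) (below i) (g x) (h x) (fun j => tie p e i j x)|]].
Proof.
move=> r0; have c0 : 0 <= band_lip eta * r by rewrite mulr_ge0 // ltW // band_lip_gt0.
(* [B1] and [B2] compare interfaces with the boundary of the polygon, [B3] and [B4] interfaces with
   each other, and [B5] the top of the slice with its bottom. *)
have [B1 [mB1 lB1 hB1]] := finite_cover (fun j => optional_cover c0
  (fun aj : above i j => concave_cover r0 (concave_onD cg (concave_oppr_tie p e i j))
     (above_top_gap aj))).
have [B2 [mB2 lB2 hB2]] := finite_cover (fun j => optional_cover c0
  (fun bj : below i j => concave_cover r0 (concave_onD ch (concave_tie p e i j))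
     (below_bot_gap bj))).
have [B3 [mB3 lB3 hB3]] := finite_cover (fun jk : 'I_m.+1 * 'I_m.+1 => optional_cover c0
  (fun a : [/\ above i jk.1, above i jk.2 & jk.1 != jk.2] => tie_pair_cover r0
     (let: And3 a1 a2 a3 := a in above_pair_gap a1 a2 a3))).
have [B4 [mB4 lB4 hB4]] := finite_cover (fun jk : 'I_m.+1 * 'I_m.+1 => optional_cover c0
  (fun a : [/\ below i jk.1, below i jk.2 & jk.1 != jk.2] => tie_pair_cover r0
     (let: And3 a1 a2 a3 := a in below_pair_gap a1 a2 a3))).
have [|B5 [mB5 lB5 hB5]] := concave_cover r0 (concave_gap p e i).
  have [x Jx hx] := thick_slice eta_gt0 (area_ge i); exists x => //.
  exact: le_trans (tie_gap_le eta_gt0) hx.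
exists (B1 `|` (B2 `|` (B3 `|` (B4 `|` B5)))); split.
- by do !apply: measurableU => //.
- have U2 (A B : set RT) (a b : R) : measurable A -> measurable B ->
      (lam A <= a%:E)%E -> (lam B <= b%:E)%E -> (lam (A `|` B) <= (a + b)%:E)%E.
    move=> mA mB lA lB; apply: (le_trans (measureU2 _ _ _)) => //.
    by rewrite EFinD; apply: leeD.
  apply: (@le_trans _ _ (#|'I_m.+1|%:R * (band_lip eta * r) +
    (#|'I_m.+1|%:R * (band_lip eta * r) +
    (#|{: 'I_m.+1 * 'I_m.+1}|%:R * (band_lip eta * r) +
     (#|{: 'I_m.+1 * 'I_m.+1}|%:R * (band_lip eta * r) + band_lip eta * r))))%:E).
    have m45 : measurable (B4 `|` B5) by apply: measurableU.
    have m345 : measurable (B3 `|` (B4 `|` B5)) by apply: measurableU.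
    have m2345 : measurable (B2 `|` (B3 `|` (B4 `|` B5))) by apply: measurableU.
    by apply: (U2) => //; apply: (U2) => //; apply: (U2) => //; apply: (U2).
  by rewrite lee_fin /tie_cover_lip le_eqVlt; apply/orP; left; apply/eqP; ring.
move=> x Jx nB; split.
- split=> [j aj|j k aj ak jk]; rewrite ltNge; apply/negP => hr; apply: nB.
    by left; apply: (hB1 j).
  by right; right; left; apply: (hB3 (j, k)).
- split=> [j aj|j k aj ak jk]; rewrite ltNge; apply/negP => hr; apply: nB.
    by right; left; apply: (hB2 j); split=> //; split=> //; rewrite /opps opprK in hr.
  right; right; right; left; apply: (hB4 (j, k)); split=> //; split=> //=.
  by move: hr; rewrite /opps -opprD normrN.
- rewrite ltNge; apply/negP => hr; apply: nB.
  by do 4 right; apply: hB5.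
Qed.

Lemma ar_taylor z s i : `|ar (p + z) (e + s) i - ar p e i - dar p e z s i|
  <= taylor_const eta * (`|z| + `|s|) ^+ 2.
Proof.
have t0 := tie_lip_gt0; have nz : 0 <= `|z| + `|s| by rewrite addr_ge0.
pose dl := tie_lip * (`|z| + `|s|).
have dl0 : 0 <= dl by rewrite mulr_ge0 // ltW.
(* [len_exact] asks for gaps larger than twice the displacement [dl]. *)
have [|B [mB lB hB]] := @tie_cover i (2 * dl); first by rewrite mulr_ge0.
have mJ := measurable_J.
rewrite !arE -RintegralB //; [|exact: integrable_slice_len..].
have mD : measurable_fun J (fun x => slice_len (p + z) (e + s) i x - slice_len p e i x).
  by apply: measurable_funB; exact: measurable_slice_len.
have db x j : J x -> `|dtie z s i j x| <= dl by move=> Jx; apply: dtie_bound.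
rewrite /dar -RintegralB //; last first.
- exact: integrable_slice_dlen.
- apply: (@integrable_J _ (2 * dl)) => // x Jx; rewrite slice_lenD.
  by apply: len_lip => // j; apply: db.
rewrite (_ : _ * _ = (2 + 2 * #|'I_m.+1|%:R) * dl * (tie_cover_lip eta * (2 * dl)));
  last by rewrite /taylor_const /dl; ring.
apply: (Rintegral_J_cover _ mB lB).
- by apply: measurable_funB => //; exact: measurable_slice_dlen.
- by rewrite mulr_ge0 //; rewrite addr_ge0 // mulr_ge0.
- by move=> x Jx; rewrite slice_lenD; apply: len_taylor => // j; apply: db.
move=> x Jx /(hB x Jx)[s1 s2 s3]; rewrite slice_lenD.
rewrite (len_exact dl0 _ s1 s2 s3) => [|j]; last exact: db.
by rewrite -/(slice_len p e i x) -/(slice_dlen p e z s i x); ring.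
Qed.

End Nondegenerate.

(** * Strong monotonicity of the areas *)

Hypothesis area_Omega : area Omega = 1%E.

Lemma area_lty (A : set (RT * RT)) : measurable A -> A `<=` Omega ->
  (mu2 A < +oo)%E.
Proof.
move=> mA AO; apply: (@le_lt_trans _ _ 1%E); last exact: ltry.
rewrite -area_Omega; apply: (@le_measure _ _ _ (lam \x lam)%E); rewrite ?inE //.
exact: measurable_Omega.
Qed.

(** Written as a degenerate region between two graphs so that [measurable_between] applies. *)
Definition tie_set p e i j : set (RT * RT) :=
  [set x | J x.1 /\ - (- tie p e i j x.1) <= x.2 <= tie p e i j x.1].

Lemma measurable_tie_set p e i j : measurable (tie_set p e i j).
Proof.
apply: (measurable_between (b := fun x1 => - tie p e i j x1));
  apply: measurable_concave_on => //.
  exact: concave_oppr_tie.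
exact: concave_tie.
Qed.

Lemma area_tie_set p e i j : mu2 (tie_set p e i j) = 0%E.
Proof.
rewrite /product_measure1; apply: integral0_eq => x _ /=.
apply: (@subset_measure0 _ _ _ lam _ [set tie p e i j x]) => //.
- exact: measurable_xsection (measurable_tie_set p e i j).
- by move=> t; rewrite /= xsectionP /tie_set /= opprK => -[_ /= ?];
    apply/le_anti; rewrite andbC.
- exact: lebesgue_measure_set1.
Qed.

Definition tie_sets p e : set (RT * RT) :=
  \big[setU/set0]_(ij : 'I_m.+1 * 'I_m.+1) tie_set p e ij.1 ij.2.

Lemma measurable_tie_sets p e : measurable (tie_sets p e).
Proof. by apply: bigsetU_measurable => ij _; exact: measurable_tie_set. Qed.

Lemma area_tie_sets p e : mu2 (tie_sets p e) = 0%E.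
Proof.
apply/eqP; rewrite eq_le measure_ge0 andbT.
apply: (@le_trans _ _ (\sum_(ij : 'I_m.+1 * 'I_m.+1) mu2 (tie_set p e ij.1 ij.2))%E).
  apply: (@measure_finite_cover _ _ _ (lam \x lam)%E _ xpredT).
  - exact: measurable_tie_sets.
  - by move=> ij; exact: measurable_tie_set.
  - by move=> x; rewrite /tie_sets -bigcup_seq => -[ij _ ?]; exists ij.
by rewrite big1 // => ij _; rewrite area_tie_set.
Qed.

Lemma cell_overlap p e i j x : i != j -> cell Omega y p e i x ->
  cell Omega y p e j x -> tie_sets p e x.
Proof.
move=> ij [Ox /min_net_costP hi] [_ /min_net_costP hj].
rewrite /tie_sets -bigcup_seq; exists (i, j); first by rewrite /= mem_index_enum.
move: Ox; rewrite OmegaE /tie_set /= opprK => -[Jx _]; split=> //.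
have Y0 : 2 * ((y j).2 - (y i).2) != 0.
  by rewrite mulf_neq0 ?pnatr_eq0 // subr_eq0 eq_sym y_distinct.
have E : net_cost y p e x i = net_cost y p e x j.
  by apply/le_anti; rewrite hi hj.
have := net_cost_tie p e x ij; rewrite E subrr => /esym/eqP.
rewrite mulf_eq0 (negbTE Y0) /= subr_eq0 => /eqP ->.
by rewrite lexx.
Qed.

Lemma exists_cell p e x : Omega x -> exists i, cell Omega y p e i x.
Proof.
move=> Ox; have [E|[i _ E]] := bmin_attained predT (net_cost y p e x ord0)
  (net_cost y p e x); first by exists ord0.
by exists i.
Qed.

Definition real_area (A : set (RT * RT)) : R := fine (mu2 A).

Lemma real_areaE (A : set (RT * RT)) : measurable A -> A `<=` Omega ->
  mu2 A = (real_area A)%:E.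
Proof. by move=> mA AO; rewrite /real_area fineK // ge0_fin_numE // area_lty. Qed.

Lemma real_area_ge0 A : 0 <= real_area A.
Proof. by rewrite /real_area fine_ge0. Qed.

Lemma cell_sub p e i : cell Omega y p e i `<=` Omega.
Proof. by move=> x []. Qed.

Lemma real_area_partition p e (A : set (RT * RT)) : measurable A -> A `<=` Omega ->
  real_area A = \sum_i real_area (A `&` cell Omega y p e i).
Proof.
move=> mA AO; apply: EFin_inj; rewrite -real_areaE // -sumEFin.
apply: etrans (@measure_ae_partition _ _ _ (lam \x lam)%E _ A
  (cell Omega y p e) (tie_sets p e) mA (area_lty mA AO) _ _ _ _ _) _.
- by move=> i; exact: measurable_cell.
- by move=> x /AO; apply: exists_cell.
- exact: measurable_tie_sets.
- exact: area_tie_sets.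
- by move=> i j x; apply: cell_overlap.
- apply: eq_bigr => i _; apply: real_areaE; first exact: measurableI (measurable_cell p e i).
  by move=> x [/AO].
Qed.

Lemma sum_ar p e : \sum_i ar p e i = 1.
Proof.
have := real_area_partition p e measurable_Omega (@subset_refl _ Omega).
rewrite /real_area -/(area Omega) area_Omega /= => ->.
apply: eq_bigr => i _; rewrite /ar /area setIidr //; exact: cell_sub.
Qed.

Section StrongMonotonicity.
Variables (p w : 'cV[R]_m) (e : R).

(** The area that passes from [k] to [l] when the prices change by [w]: summing over [l] gives the
    old areas, over [k] the new ones. *)
Definition flow k l : R :=
  real_area (cell Omega y p e k `&` cell Omega y (p + w) e l).

Lemma flow_ge0 k l : 0 <= flow k l.
Proof. exact: real_area_ge0. Qed.

(** At a common point, adding the optimality of [k] before the change to that of [l] after it leaves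
    only the increments. *)
Lemma flow_neq0 k l : flow k l != 0 -> price w k <= price w l.
Proof.
apply: contraNle => kl; rewrite /flow.
suff -> : cell Omega y p e k `&` cell Omega y (p + w) e l = set0.
  by rewrite /real_area measure0.
apply/seteqP; split=> // x [[_ /min_net_costP hk] [_ /min_net_costP hl]].
have := hk l; have := hl k; move: kl.
by rewrite /net_cost !priceD; lra.
Qed.

Lemma ar_outflow k : ar p e k = \sum_l flow k l.
Proof. by apply: real_area_partition; [exact: measurable_cell|exact: cell_sub]. Qed.

Lemma ar_inflow l : ar (p + w) e l = \sum_k flow k l.
Proof.
apply: (etrans (real_area_partition p e (measurable_cell (p + w) e l) (@cell_sub _ _ _))).
by apply: eq_bigr => k _; rewrite setIC.
Qed.

(** Old areas are outflows and new areas are inflows, so the sum regroups transfer by transfer. *)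
Lemma monotone_flow : \sum_k price w k * (ar (p + w) e k - ar p e k) =
  \sum_k \sum_l flow k l * (price w l - price w k).
Proof.
have E1 : \sum_k price w k * ar (p + w) e k = \sum_k \sum_l flow k l * price w l.
  rewrite exchange_big /=; apply: eq_bigr => l _.
  by rewrite ar_inflow mulr_sumr; apply: eq_bigr => k _; rewrite mulrC.
have E2 : \sum_k price w k * ar p e k = \sum_k \sum_l flow k l * price w k.
  apply: eq_bigr => k _; rewrite ar_outflow mulr_sumr.
  by apply: eq_bigr => l _; rewrite mulrC.
under eq_bigr do rewrite mulrBr.
rewrite sumrB E1 E2 -sumrB; apply: eq_bigr => k _; rewrite -sumrB.
by apply: eq_bigr => l _; rewrite mulrBr.
Qed.

Lemma flow_term_ge0 k l : 0 <= flow k l * (price w l - price w k).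
Proof.
have [->|/flow_neq0 kl] := eqVneq (flow k l) 0; first by rewrite mul0r.
by rewrite mulr_ge0 ?flow_ge0 // subr_ge0.
Qed.

(** All terms of the regrouped sum are nonnegative. Only transfers across the cut are kept, and each
    gains at least [gp]. *)
Lemma monotone_ge_flow c gp : 0 <= gp ->
  gp * (\sum_(kl : 'I_m.+1 * 'I_m.+1 |
      (price w kl.1 <= c) && (c + gp <= price w kl.2))
     flow kl.1 kl.2) <= \sum_k price w k * (ar (p + w) e k - ar p e k).
Proof.
move=> gp0; rewrite monotone_flow pair_big /= mulr_sumr [leLHS]big_mkcond /=.
apply: ler_sum => -[k l] _ /=; case: ifP => [/andP[kc cl]|_]; last exact: flow_term_ge0.
by rewrite mulrC ler_wpM2l ?flow_ge0 //; lra.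
Qed.

End StrongMonotonicity.

(** * Squares inside thick cells *)

Lemma Omega_bound x : Omega x -> `|x.1| <= D /\ `|x.2| <= D.
Proof.
rewrite OmegaE /= => -[Jx /andP[hx gx]]; rewrite !ler_norml.
have gx' := gD Jx; have hx' := hD Jx; split; first exact: JD.
by apply/andP; split; lra.
Qed.

Lemma Omega_conv a b th : Omega a -> Omega b -> 0 <= th <= 1 ->
  Omega ((1 - th) * a.1 + th * b.1, (1 - th) * a.2 + th * b.2).
Proof.
rewrite OmegaE /= => -[Ja /andP[ha ga]] [Jb /andP[hb gb]] th01.
have /andP[th0 th1] := th01; split; first exact: is_interval_conv.
have th2 : 0 <= 1 - th by lra.
apply/andP; split; last first.
  apply: le_trans (cg Ja Jb th01); apply: lerD; exact: ler_wpM2l.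
rewrite lerNl; apply: le_trans (ch Ja Jb th01); rewrite opprD -!mulrN.
by apply: lerD; apply: ler_wpM2l; rewrite // lerNl.
Qed.

(* Every cell of area at least [eta] has two thick slices [fat_width eta] apart
   and contains a square of half side [inradius eta]. *)
Definition fat_width eta : R := eta / (16 * D).
Definition inradius eta : R :=
  eta / (4 * D) * fat_width eta / (2 * (fat_width eta + 2 * D)).

(** Otherwise the slices of length at least [eta / (4 * D)] lie over an interval of length at most
    [2 * fat_width eta], and the area is at most [eta / 2 + eta / 4]. *)
Lemma fat_slices p e i eta : 0 < eta -> eta <= ar p e i ->
  exists s t, [/\ J s, J t, fat_width eta <= t - s,
    eta / (4 * D) <= top p e i s + bot p e i s &
    eta / (4 * D) <= top p e i t + bot p e i t].
Proof.
move=> eta0 hi; have D0 := D_gt0; apply: contrapT => hn.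
have k0 : 0 < eta / (4 * D) by rewrite divr_gt0 //; lra.
have w0 : 0 <= fat_width eta by rewrite divr_ge0 //; lra.
have [|B [mB lB hB]] := @diameter_cover _
  [set x | J x /\ eta / (4 * D) <= top p e i x + bot p e i x] _ w0.
  move=> s t [Js hs] [Jt ht] st; rewrite leNgt; apply/negP => lt.
  by apply: hn; exists s, t; split=> //; apply: ltW.
(* The excess of the slice length over the threshold vanishes off [B]. *)
pose u x := Num.max 0 (slice_len p e i x - eta / (4 * D)).
have mu : measurable_fun J u.
  apply: measurable_maxr; first exact: measurable_cst.
  by apply: measurable_funB; [exact: measurable_slice_len|exact: measurable_cst].
have uM x : J x -> `|u x| <= 2 * D.
  move=> Jx; have := slice_len_le p e i Jx => h1.
  have u0 : 0 <= u x by rewrite /u le_max lexx.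
  by rewrite ger0_norm // /u ge_max; apply/andP; split; lra.
have uB x : J x -> ~ B x -> u x = 0.
  move=> Jx nB; apply/max_l; rewrite subr_le0 /slice_len /len slice_gapE.
  rewrite ge_max (ltW k0) /= leNgt; apply/negP => lt.
  by apply: nB; apply: hB; split=> //; apply: ltW.
have D20 : 0 <= 2 * D by lra.
have h1 := Rintegral_J_cover mu mB lB D20 uM uB.
have h2 : `|\int[lam]_(x in J) (eta / (4 * D))| <= eta / (4 * D) * (2 * D).
  apply: Rintegral_J_bound => //; first exact: ltW.
  by move=> x _; rewrite ger0_norm // ltW.
have h3 : ar p e i <= \int[lam]_(x in J) (eta / (4 * D)) + \int[lam]_(x in J) u x.
  have i1 : lam.-integrable J (EFin \o (fun=> eta / (4 * D))).
    apply: (@integrable_J _ (eta / (4 * D))) => // x _.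
    by rewrite ger0_norm // ltW.
  have i2 := integrable_J mu uM.
  rewrite arE -RintegralD //; last exact: measurable_J.
  apply: le_Rintegral; [exact: measurable_J|exact: integrable_slice_len| |].
    apply: (@integrable_J _ (eta / (4 * D) + 2 * D)).
      by apply: measurable_funD.
    move=> x Jx; apply: le_trans (ler_normD _ _) _; apply: lerD; last exact: uM.
    by rewrite ger0_norm // ltW.
  move=> x Jx; rewrite /u.
  by have [lt|lt] := leP 0 (slice_len p e i x - eta / (4 * D)); lra.
have := le_trans hi h3.
have := le_trans (ler_norm _) h1; have := le_trans (ler_norm _) h2.
have -> : eta / (4 * D) * (2 * D) = eta / 2 by field; lra.
have -> : 2 * D * (2 * fat_width eta) = eta / 4 by rewrite /fat_width; field; lra.
by lra.
Qed.

Lemma inradius_gt0 eta : 0 < eta -> 0 < inradius eta.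
Proof.
move=> eta0; have D0 := D_gt0.
have t0 : 0 < fat_width eta by rewrite divr_gt0 //; lra.
apply: divr_gt0; last by lra.
by apply: mulr_gt0 => //; rewrite divr_gt0 //; lra.
Qed.

(** By concavity the cell contains the trapezoid spanned by two thick slices, and the square sits at
    its centre. *)
Lemma inner_square p e i eta : 0 < eta -> eta <= ar p e i ->
  exists c : R * R, forall x : R * R, `|x.1 - c.1| <= inradius eta ->
    `|x.2 - c.2| <= inradius eta -> cell Omega y p e i x.
Proof.
move=> eta0 hi; have D0 := D_gt0.
have [s [t [Js Jt st ks kt]]] := fat_slices eta0 hi.
have t0 : 0 < fat_width eta by rewrite divr_gt0 //; lra.
set k := eta / (4 * D) in ks kt; set tau := fat_width eta in t0 st.
have k0 : 0 < k by rewrite divr_gt0 //; lra.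
set Ts := top p e i s in ks; set Tt := top p e i t in kt.
set Bs := bot p e i s in ks; set Bt := bot p e i t in kt.
have TsD : Ts <= D by apply: le_trans (bmin_le_id _ _ _) (gD Js).
have TtD : Tt <= D by apply: le_trans (bmin_le_id _ _ _) (gD Jt).
have BsD : Bs <= D by apply: le_trans (bmin_le_id _ _ _) (hD Js).
have BtD : Bt <= D by apply: le_trans (bmin_le_id _ _ _) (hD Jt).
have nTs : `|Ts| <= D by rewrite ler_norml TsD andbT; lra.
have nTt : `|Tt| <= D by rewrite ler_norml TtD andbT; lra.
have nBs : `|Bs| <= D by rewrite ler_norml BsD andbT; lra.
have nBt : `|Bt| <= D by rewrite ler_norml BtD andbT; lra.
have rho0 := inradius_gt0 eta0; set rho := inradius eta in rho0 *.
have Erho : rho * (2 * (tau + 2 * D)) = k * tau.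
  by rewrite /rho /inradius -/k -/tau; field; lra.
(* This determines the radius: the middle slice has half length at least [k / 2], and a horizontal
   move by [rho] costs at most [k / 2 - rho] at either end, which leaves [rho]. *)
have Erate : (k / 2 - rho) * tau = rho * ((1 + 1) * D).
  by rewrite mulrBl; lra.
have rho_tau : 2 * rho <= tau by nra.
(* The mean of the midpoints of the two slices. *)
exists ((s + t) / 2, (Ts + Tt - Bs - Bt) / 4) => -[x1 x2] /= hx1 hx2.
apply/cellE => /=.
pose th := (x1 - s) / (t - s).
have ts0 : 0 < t - s by lra.
have Eth : th * (t - s) = x1 - s by rewrite /th divfK //; lra.
have hd : `|th - 2^-1| * tau <= rho.
  apply: (@le_trans _ _ (`|th - 2^-1| * (t - s))); first by rewrite ler_wpM2l.
  rewrite -[t - s]gtr0_norm // -normrM mulrBl Eth.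
  by rewrite (_ : _ - _ = x1 - (s + t) / 2) //; field.
have hth : `|th - 2^-1| <= 2^-1.
  rewrite -(ler_pM2r t0); apply: (le_trans hd).
  by rewrite -(ler_pM2l (ltr0n _ 2)) mulrA mulfV ?mul1r //; lra.
have th01 : 0 <= th <= 1.
  by move: hth; rewrite ler_norml => /andP[? ?]; apply/andP; split; lra.
have Ex1 : x1 = (1 - th) * s + th * t by rewrite mulrBl mul1r; nra.
have Jx1 : J x1 by rewrite Ex1; apply: is_interval_conv.
split=> //.
have Tx : (1 - th) * Ts + th * Tt <= top p e i x1.
  by have := @concave_top p e i _ _ _ Js Jt th01; rewrite -Ex1.
have Bx : (1 - th) * Bs + th * Bt <= bot p e i x1.
  by have := @concave_bot p e i _ _ _ Js Jt th01; rewrite -Ex1.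
have slope a b : `|a| <= D -> `|b| <= D ->
    `|(th - 2^-1) * (b - a)| <= k / 2 - rho.
  move=> aD bD; rewrite -(ler_pM2r t0) Erate normrM mulrAC; apply: ler_pM => //.
    by rewrite mulr_ge0 // ltW.
  apply: le_trans (ler_normB _ _) _.
  by rewrite mulrDl mul1r; apply: lerD.
have sT := slope Ts Tt nTs nTt; have sB := slope Bs Bt nBs nBt.
clear - hx2 sT sB ks kt Tx Bx.
move: hx2 sT sB; rewrite !ler_norml => /andP[? ?] /andP[? ?] /andP[? ?].
by apply/andP; split; lra.
Qed.

(** * Points that change sides of a cut *)

Section Crossing.
Variables (p w : 'cV[R]_m) (e c gp : R).
Hypothesis e01 : 0 <= e <= 1.
Hypothesis gap_dichotomy : forall k, price w k <= c \/ c + gp <= price w k.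

(** The difference of two net costs is affine in the point, with slopes at most [4 * D] in each
    coordinate because [e <= 1]. *)
Lemma net_cost_diff (x x' : R * R) a b dl : `|x.1 - x'.1| <= dl ->
  `|x.2 - x'.2| <= dl ->
  net_cost y p e x a - net_cost y p e x b
    <= net_cost y p e x' a - net_cost y p e x' b + 8 * D * dl.
Proof.
move=> h1 h2; have D0 := D_gt0; have /andP[e0 e1] := e01.
have dl0 : 0 <= dl by apply: le_trans h1.
have [a1 a2] := yD a; have [b1 b2] := yD b.
have s1 : `|e * ((y b).1 - (y a).1) * (x.1 - x'.1)| <= 2 * D * dl.
  rewrite !normrM; apply: ler_pM => //.
  rewrite -[leRHS]mul1r; apply: ler_pM => //; first by rewrite ger0_norm; lra.
  by apply: le_trans (ler_normB _ _) _; lra.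
have s2 : `|((y b).2 - (y a).2) * (x.2 - x'.2)| <= 2 * D * dl.
  rewrite !normrM; apply: ler_pM => //.
  by apply: le_trans (ler_normB _ _) _; lra.
move: s1 s2; rewrite !ler_norml => /andP[_ s1] /andP[_ s2].
rewrite -lerBDl /net_cost /cost.
rewrite (_ : _ - _ = 2 * (e * ((y b).1 - (y a).1) * (x.1 - x'.1)) +
  2 * (((y b).2 - (y a).2) * (x.2 - x'.2))); last by ring.
lra.
Qed.

(** At [x], before the change, [k] is worse than any other index by at most [8 * D * dl]. Against an
    index with increment at most [c] it gains at least [gp], which compensates. *)
Lemma crossing_transfer (x x' : R * R) k dl : Omega x ->
  `|x.1 - x'.1| <= dl -> `|x.2 - x'.2| <= dl -> 8 * D * dl <= gp ->
  cell Omega y p e k x' -> c + gp <= price w k ->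
  exists2 l, c + gp <= price w l & cell Omega y (p + w) e l x.
Proof.
move=> Ox h1 h2 hgp [_ /min_net_costP hk] ck.
have [l hl] := exists_cell (p + w) e Ox.
have [lc|] := gap_dichotomy l; last by exists l.
exists k => //; split=> //; apply/min_net_costP => b.
have [_ /min_net_costP hl'] := hl.
apply: le_trans (hl' b).
have := @net_cost_diff x x' k l dl h1 h2; have := hk l.
by rewrite /net_cost !priceD; lra.
Qed.

(** Walk from [x] to its translate in [n] equal steps. Right after the last position in a cell with
    low increment comes one with high increment, close enough for [crossing_transfer]. *)
Lemma crossing (x v : R * R) i j n : (0 < n)%N -> 16 * D ^+ 2 <= gp * n%:R ->
  0 <= gp ->
  cell Omega y p e i x -> cell Omega y p e j (translate v x) ->
  price w i <= c -> c + gp <= price w j ->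
  exists t : 'I_n.+1, exists k l, [/\ price w k <= c, c + gp <= price w l &
    (cell Omega y p e k `&` cell Omega y (p + w) e l)
      (translate (t%:R / n%:R * v.1, t%:R / n%:R * v.2) x)].
Proof.
move=> n0 hn gp0 Ci Cj ic cj; have D0 := D_gt0.
have nR : 0 < n%:R :> R by rewrite ltr0n.
pose z (t : nat) := translate (t%:R / n%:R * v.1, t%:R / n%:R * v.2) x.
have Ox : Omega x by case: Ci.
have Ov : Omega (translate v x) by case: Cj.
have Oz t : (t <= n)%N -> Omega (z t).
  move=> tn; have := @Omega_conv _ _ (t%:R / n%:R) Ox Ov.
  rewrite (_ : (_, _) = z t); last by rewrite /z /translate /=; congr pair; ring.
  apply; rewrite divr_ge0 //= ler_pdivrMr // mul1r ler_nat //.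
pose low t := (t <= n)%N && `[< exists2 k, price w k <= c & cell Omega y p e k (z t) >].
have z0 : z 0%N = x by rewrite /z /translate /= !mul0r !addr0; case: (x).
have exlow : exists t, low t.
  by exists 0%N; rewrite /low /=; apply/asboolP; exists i; rewrite ?z0.
have low_le t : low t -> (t <= n)%N by case/andP.
case: (ex_maxnP exlow low_le) => t /andP[tn /asboolP[k kc Ck]] tmax.
have [l lc Dl] : exists2 l, c + gp <= price w l & cell Omega y (p + w) e l (z t).
  (* The last low position may be the endpoint, which then also lies in the cell of [j]; the
     distance to move is 0. *)
  have [tn'|tn'] := leqP n t.
    have En : t = n by apply/eqP; rewrite eqn_leq tn.
    have zn : z t = translate v x.
      by rewrite /z En divff ?pnatr_eq0 -?lt0n // !mul1r.
    apply: (@crossing_transfer _ (translate v x) j 0) => //; rewrite ?zn ?subrr ?normr0 //.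
    by rewrite mulr0.
  have [l Cl] := exists_cell p e (Oz t.+1 tn').
  have lc : c + gp <= price w l.
    have [lc|//] := gap_dichotomy l.
    have : low t.+1 by rewrite /low tn'; apply/asboolP; exists l.
    by move=> /tmax; rewrite ltnn.
  have step a b : `|(b + a) - b| <= 2 * D ->
      `|t%:R / n%:R * a - t.+1%:R / n%:R * a| <= 2 * D / n%:R.
    rewrite addrAC subrr add0r => aD.
    rewrite (_ : _ - _ = - (a / n%:R)); last by rewrite -natr1; ring.
    by rewrite normrN normrM normfV normr_nat ler_wpM2r // invr_ge0.
  have [ox1 ox2] := Omega_bound Ox; have [ov1 ov2] := Omega_bound Ov.
  apply: (@crossing_transfer _ (z t.+1) l (2 * D / n%:R)) => //.
  - exact: Oz.
  - rewrite /z /translate /= opprD addrACA subrr add0r; apply: (step _ x.1).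
    by apply: le_trans (ler_normB _ _) _; move: ov1; rewrite /translate /=; lra.
  - rewrite /z /translate /= opprD addrACA subrr add0r; apply: (step _ x.2).
    by apply: le_trans (ler_normB _ _) _; move: ov2; rewrite /translate /=; lra.
  - rewrite mulrA ler_pdivrMr //; lra.
by exists (Ordinal (tn : t < n.+1)%N), k, l.
Qed.

End Crossing.

(** Each point of a square in the cell of [a] is carried into a transfer set by one of [n.+1]
    translations, so the flow across the cut is at least the area of the square divided by
    [n.+1]. *)
Lemma strong_monotone_gap p w e eta : 0 < eta -> (forall k, eta <= ar p e k) ->
  0 <= e <= 1 -> w != 0 ->
  4 * inradius eta ^+ 2 * (`|w| / m.+1%:R) ^+ 2 / (16 * D ^+ 2 + 2 * (`|w| / m.+1%:R))
    <= \sum_k price w k * (ar (p + w) e k - ar p e k).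
Proof.
move=> eta0 area_ge e01 w0; set gp := `|w| / _; set rho := inradius eta.
have D0 := D_gt0; have rho0 : 0 < rho := inradius_gt0 eta0.
have nw : 0 < `|w| by rewrite normr_gt0.
have gp0 : 0 < gp by rewrite divr_gt0.
(* One of the two is the first index, with increment 0; the other attains the norm of [w]. *)
have [a [b Eab]] : exists a b, price w b - price w a = `|w|.
  have [i hi] := price_norm_attained w; case: (leP 0 (price w i)) => s.
    by exists ord0, i; rewrite price_ord0 subr0 -hi ger0_norm.
  by exists i, ord0; rewrite price_ord0 sub0r -hi ltr0_norm.
have ab : price w a < price w b by rewrite -subr_gt0 Eab.
have [c] := value_gap ab; rewrite Eab -/gp => -[ac cb dich].
have [ca hca] := inner_square eta0 (area_ge a).
have [cb' hcb] := inner_square eta0 (area_ge b).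
pose v : R * R := (cb'.1 - ca.1, cb'.2 - ca.2).
(* Fine enough for [crossing], yet [n.+1%:R * gp] stays below [16 * D ^+ 2 + 2 * gp]. *)
pose n := (Num.truncn (16 * D ^+ 2 / gp)).+1.
have D2 : 0 <= 16 * D ^+ 2 / gp.
  by rewrite divr_ge0 ?(ltW gp0) // mulr_ge0 // sqr_ge0.
have /andP[n1 n2] := truncn_itv D2.
have hn : 16 * D ^+ 2 <= gp * n%:R.
  by rewrite (mulrC gp) -ler_pdivrMr //; apply: ltW.
pose sq : set (RT * RT) := `[ca.1 - rho, ca.1 + rho]%classic `*`
  `[ca.2 - rho, ca.2 + rho]%classic.
have sqE x : sq x -> `|x.1 - ca.1| <= rho /\ `|x.2 - ca.2| <= rho.
  by rewrite /sq /= !in_itv /= !ler_distl => -[].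
have msq : measurable sq by apply: measurableX; exact: measurable_itv.
have lam_itv (u : R) : lam `[u - rho, u + rho]%classic = (2 * rho)%:E.
  have lt : u - rho < u + rho by lra.
  by rewrite lebesgue_measure_itv /= lte_fin lt -EFinB; congr EFin; ring.
have area_sq : mu2 sq = ((2 * rho) ^+ 2)%:E.
  rewrite /sq product_measure1E; [|exact: measurable_itv..].
  by rewrite expr2 EFinM; congr (_ * _)%E; exact: lam_itv.
pose I := ('I_n.+1 * ('I_m.+1 * 'I_m.+1))%type.
pose P (tkl : I) := (price w tkl.2.1 <= c) && (c + gp <= price w tkl.2.2).
pose F (tkl : I) : set (RT * RT) :=
  translate (tkl.1%:R / n%:R * v.1, tkl.1%:R / n%:R * v.2) @^-1`
    (cell Omega y p e tkl.2.1 `&` cell Omega y (p + w) e tkl.2.2).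
have mcc k l : measurable (cell Omega y p e k `&` cell Omega y (p + w) e l : set (RT * RT)).
  by apply: measurableI; exact: measurable_cell.
have mF tkl : measurable (F tkl).
  rewrite -[X in measurable X]setTI; apply: measurable_translate => //.
have cover : (mu2 sq <= \sum_(tkl : I | P tkl) mu2 (F tkl))%E.
  apply: (@measure_finite_cover _ _ _ (lam \x lam)%E _ P) => // x /sqE[x1 x2].
  have [|t [k [l [kc lc hx]]]] := crossing e01 dich (isT : (0 < n)%N) hn (ltW gp0)
    (hca x x1 x2) (_ : cell Omega y p e b (translate v x)) ac cb.
    apply: hcb; rewrite /translate /v /=.
      by rewrite (_ : _ - _ = x.1 - ca.1) //; ring.
    by rewrite (_ : _ - _ = x.2 - ca.2) //; ring.
  by exists (t, (k, l)); rewrite // /P /= kc lc.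
pose S := \sum_(kl : 'I_m.+1 * 'I_m.+1 |
    (price w kl.1 <= c) && (c + gp <= price w kl.2))
   flow p w e kl.1 kl.2.
have hS : (2 * rho) ^+ 2 <= n.+1%:R * S.
  rewrite -lee_fin -area_sq; apply: (le_trans cover).
  rewrite (eq_bigr (fun tkl : I => (flow p w e tkl.2.1 tkl.2.2)%:E)) => [|tkl _].
    rewrite sumEFin lee_fin -(pair_big xpredT
      (fun kl : 'I_m.+1 * 'I_m.+1 => (price w kl.1 <= c) && (c + gp <= price w kl.2))
      (fun _ kl => flow p w e kl.1 kl.2)) /= sumr_const card_ord -/S.
    by rewrite mulr_natl.
  apply: (etrans (area_translate _ (mcc _ _))).
  by apply: real_areaE => // x [[]].
have := monotone_ge_flow p w e c (ltW gp0); rewrite -/S => hM.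
apply: le_trans hM.
have den : 0 < 16 * D ^+ 2 + 2 * gp by have := sqr_ge0 D; lra.
rewrite ler_pdivrMr //.
have h1 : n.+1%:R * gp <= 16 * D ^+ 2 + 2 * gp.
  have : n%:R <= 16 * D ^+ 2 / gp + 1 by rewrite /n -natr1 lerD2r.
  rewrite -(ler_pM2r gp0) mulrDl mul1r divfK ?gt_eqF // => h0.
  by rewrite -natr1 mulrDl mul1r; lra.
have S0 : 0 <= S by apply: sumr_ge0 => kl _; exact: flow_ge0.
apply: (@le_trans _ _ (gp * S * (n.+1%:R * gp))); last first.
  by apply: ler_wpM2l => //; rewrite mulr_ge0 // ltW.
have -> : 4 * rho ^+ 2 * gp ^+ 2 = gp ^+ 2 * (2 * rho) ^+ 2 by ring.
have -> : gp * S * (n.+1%:R * gp) = gp ^+ 2 * (n.+1%:R * S) by ring.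
by apply: ler_wpM2l => //; exact: sqr_ge0.
Qed.

Definition mono_const eta : R :=
  4 * inradius eta ^+ 2 / (m.+1%:R ^+ 2 * (16 * D ^+ 2 + 2)).

Lemma mono_const_gt0 eta : 0 < eta -> 0 < mono_const eta.
Proof.
move=> eta0; have := inradius_gt0 eta0 => r0; have D2 := sqr_ge0 D.
apply: divr_gt0; first by rewrite mulr_gt0 // exprn_gt0.
by rewrite mulr_gt0 ?exprn_gt0 ?ltr0n //; lra.
Qed.

(** The denominator of [strong_monotone_gap] is at most [16 * D ^+ 2 + 2] when [|w| < 1] and at most
    [|w|] times that otherwise; the latter case loses one power of [|w|]. *)
Lemma strong_monotone p w e eta : 0 < eta -> (forall k, eta <= ar p e k) ->
  0 <= e <= 1 -> mono_const eta * `|w| * Num.min 1 `|w|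
    <= \sum_k price w k * (ar (p + w) e k - ar p e k).
Proof.
move=> eta0 area_ge e01; have [->|w0] := eqVneq w 0.
  rewrite normr0 mulr0 mul0r sumr_ge0 // => k _.
  by rewrite addr0 subrr mulr0.
apply: le_trans (strong_monotone_gap eta0 area_ge e01 w0).
have nw : 0 < `|w| by rewrite normr_gt0.
have D2 := sqr_ge0 D; have N1 : 1 <= m.+1%:R :> R by rewrite ler1n.
have rho2 : 0 <= 4 * inradius eta ^+ 2 by rewrite mulr_ge0 // sqr_ge0.
set N := m.+1%:R in N1 *; set W := `|w| in nw *; set q := D ^+ 2 in D2 *.
have E2 : 4 * inradius eta ^+ 2 * (W / N) ^+ 2 / (16 * q + 2 * (W / N)) =
  4 * inradius eta ^+ 2 / N ^+ 2 * (W ^+ 2 / (16 * q + 2 * (W / N))).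
  by rewrite [(W / N) ^+ 2]expr_div_n; move: (_ + _)^-1 => G; ring.
have E1 : mono_const eta * W * Num.min 1 W =
  4 * inradius eta ^+ 2 / N ^+ 2 * (W * Num.min 1 W / (16 * q + 2)).
  by rewrite /mono_const -/N -/q invfM; move: (_ + _)^-1 => G; ring.
rewrite E1 E2; apply: ler_wpM2l.
  by rewrite divr_ge0 // sqr_ge0.
have WN : W / N <= W by rewrite ler_pdivrMr; nra.
have WN0 : 0 < W / N by rewrite divr_gt0 //; lra.
have den1 : 0 < 16 * q + 2 * (W / N) by apply: ltr_wpDl; [exact: mulr_ge0|exact: mulr_gt0].
have den2 : 0 < 16 * q + 2 by lra.
rewrite ler_pdivrMr // [leRHS]mulrAC ler_pdivlMr //.
clearbody N W q; move: (W / N) WN WN0 den1 => G WN WN0 den1.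
have [W1|W1] := leP 1 W; rewrite ?mulr1.
  have : W * (16 * q + 2 * G) <= W * (W * (16 * q + 2)).
    apply: ler_wpM2l; first exact: ltW.
    have : 0 <= q * (W - 1) by rewrite mulr_ge0 // subr_ge0.
    lra.
  by rewrite expr2 -mulrA.
rewrite -expr2; apply: ler_wpM2l; first exact: sqr_ge0.
by lra.
Qed.

(** * Derivatives of Phi *)

Lemma measurable_net_cost p e i :
  measurable_fun setT (fun x : RT * RT => net_cost y p e x i).
Proof.
rewrite /net_cost /cost.
have m1 : measurable_fun setT (fst : RT * RT -> R) by exact: measurable_fst.
have m2 : measurable_fun setT (snd : RT * RT -> R) by exact: measurable_snd.
apply: measurable_funB => //; apply: measurable_funD.
  by apply: measurable_funM => //; apply: measurable_funX; apply: measurable_funB.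
by apply: measurable_funX; apply: measurable_funB.
Qed.

Lemma measurable_min_net_cost p e :
  measurable_fun (Omega : set (RT * RT)) (min_net_cost y p e).
Proof.
apply: measurable_funTS; rewrite /min_net_cost.
elim: (index_enum _) => [|i s ih].
  by under eq_fun do rewrite big_nil; exact: measurable_net_cost.
under eq_fun do rewrite big_cons /=.
by apply: measurable_minr => //; exact: measurable_net_cost.
Qed.

Lemma integrable_Omega (u : RT * RT -> R) (M : R) :
  measurable_fun (Omega : set (RT * RT)) u ->
  (forall x, Omega x -> `|u x| <= M) -> (lam \x lam)%E.-integrable Omega (EFin \o u).
Proof.
move=> mu uM; apply: measurable_bounded_integrable => //.
- exact: measurable_Omega.
- by apply: area_lty => //; exact: measurable_Omega.
- exists M; split; first exact: num_real.
  by move=> t Mt x Ox; apply: le_trans (uM x Ox) (ltW Mt).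
Qed.

Lemma integrable_min_net_cost p e :
  (lam \x lam)%E.-integrable Omega (EFin \o min_net_cost y p e).
Proof.
apply: (@integrable_Omega _ (`|e| * (2 * D) ^+ 2 + (2 * D) ^+ 2 + `|p|)).
  exact: measurable_min_net_cost.
move=> x Ox; have [i [_ ->]] := exists_cell p e Ox.
have [x1 x2] := Omega_bound Ox; have [y1 y2] := yD i.
have D0 := D_gt0.
have sq a b : `|a| <= D -> `|b| <= D -> `|a - b| ^+ 2 <= (2 * D) ^+ 2.
  move=> ha hb; rewrite lerXn2r ?nnegrE //; first by lra.
  by apply: le_trans (ler_normB _ _) _; lra.
rewrite /net_cost /cost; apply: le_trans (ler_normB _ _) _.
apply: lerD; last exact: price_norm.
apply: le_trans (ler_normD _ _) _; apply: lerD; last by rewrite normrX; apply: sq.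
by rewrite normrM normrX; apply: ler_wpM2l => //; apply: sq.
Qed.

Lemma norm_delta (j : 'I_m) : `|delta_mx j 0 : 'cV[R]_m| <= 1.
Proof.
have [l <-] := price_norm_attained (delta_mx j 0 : 'cV[R]_m).
rewrite -[delta_mx j 0]scale1r priceZ mul1r.
case: (unliftP ord0 l) => [k|] ->; last by rewrite price_ord0 normr0.
by rewrite price_lift mxE; case: (_ && _); rewrite ?normr1 ?normr0.
Qed.

Definition cost_integral p e : R :=
  \int[(lam \x lam)%E]_(x in Omega) min_net_cost y p e x.

Lemma price_delta (t : R) (j : 'I_m) k :
  price (t *: (delta_mx j 0 : 'cV[R]_m)) k = t * (k == lift ord0 j)%:R.
Proof.
rewrite priceZ; congr (_ * _); case: (unliftP ord0 k) => [k'|] ->.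
  by rewrite price_lift mxE eqxx andbT (inj_eq lift_inj).
by rewrite price_ord0; case: eqP.
Qed.

(** The old assignment of points to cells is still a competitor at the new prices, and its cost
    changes by [- t] on one cell only. *)
Lemma cost_integral_le p e t (j : 'I_m) :
  cost_integral (p + t *: delta_mx j 0) e <=
  cost_integral p e - t * ar p e (lift ord0 j).
Proof.
set k := lift ord0 j; set C := cell Omega y p e k.
have mC : measurable (C : set (RT * RT)) by exact: measurable_cell.
have mO := measurable_Omega.
have i1 := integrable_min_net_cost p e.
have i2 : (lam \x lam)%E.-integrable Omega (EFin \o (\1_C : RT * RT -> R)).
  apply: (@integrable_Omega _ 1); first exact: measurable_indic.
  by move=> x _; rewrite indicE; case: (_ \in _); rewrite ?normr1 ?normr0.
have i3 : (lam \x lam)%E.-integrable Omega (EFin \o (fun x => t * (\1_C x : R))).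
  apply: (@integrable_Omega _ `|t|).
    by apply: measurable_funM => //; exact: measurable_indic.
  move=> x _; rewrite indicE; case: (_ \in _); rewrite ?mulr1 ?mulr0 ?normr0 //.
have -> : ar p e k = \int[(lam \x lam)%E]_(x in Omega) (\1_C x : R).
  by rewrite /Rintegral integral_indic // setIidl //; exact: cell_sub.
rewrite /cost_integral -RintegralZl // -RintegralB //.
apply: le_Rintegral => //; first exact: integrable_min_net_cost.
  have := integrableB mO i1 i3; exact: eq_integrable.
move=> x Ox; rewrite indicE.
have low l : min_net_cost y (p + t *: delta_mx j 0) e x <=
    net_cost y p e x l - t * (l == k)%:R.
  apply: le_trans (_ : net_cost y (p + t *: delta_mx j 0) e x l <= _).
    exact: bigmin_le_cond.
  by rewrite /net_cost priceD price_delta opprD addrA.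
case: (boolP (x \in C)) => [/set_mem[_ Ex]|nC].
  by rewrite Ex; have := low k; rewrite eqxx.
have [l Cl] := exists_cell p e Ox; have [_ ->] := Cl.
have := low l; rewrite (_ : (l == k) = false) //.
by apply/negbTE; apply: contraNneq nC => E; apply: mem_set; rewrite /C -E.
Qed.

Definition unit_ar_lip : R := 4 * D * tie_lip.

Lemma unit_ar_lip_ge0 : 0 <= unit_ar_lip.
Proof.
by rewrite /unit_ar_lip; have := tie_lip_gt0; have := D_gt0 => D0 t0;
  apply: mulr_ge0; [apply: mulr_ge0 => //|]; apply: ltW.
Qed.

Lemma ar_shift_lip p e t (j : 'I_m) i :
  `|ar (p + t *: delta_mx j 0) e i - ar p e i| <= unit_ar_lip * `|t|.
Proof.
have := ar_lip p (t *: delta_mx j 0) e 0 i; rewrite addr0 normr0 addr0 => h1.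
apply: (le_trans h1); apply: ler_wpM2l.
  exact: unit_ar_lip_ge0.
rewrite normrZ -[leRHS]mulr1; apply: ler_wpM2l => //.
exact: norm_delta.
Qed.

Lemma sum_price_delta t (j : 'I_m) p :
  \sum_i price (p + t *: delta_mx j 0) i = \sum_i price p i + t.
Proof.
under eq_bigr do rewrite priceD price_delta.
rewrite big_split /= -mulr_sumr; congr (_ + _).
rewrite (bigD1 (lift ord0 j)) //= eqxx big1 ?addr0 ?mulr1 //.
by move=> i /negbTE ->.
Qed.

Lemma PhiE p e :
  Phi Omega y p e = m.+1%:R^-1 * \sum_i price p i + cost_integral p e.
Proof. by []. Qed.

Lemma Phi_upper p e t (j : 'I_m) :
  Phi Omega y (p + t *: delta_mx j 0) e <=
  Phi Omega y p e + t * (m.+1%:R^-1 - ar p e (lift ord0 j)).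
Proof.
have := cost_integral_le p e t j; rewrite !PhiE sum_price_delta.
by move: (m.+1%:R^-1) => iN; rewrite mulrDr mulrBr [t * iN]mulrC; lra.
Qed.

(** This is [Phi_upper] from the shifted prices with the opposite step. *)
Lemma Phi_lower p e t (j : 'I_m) :
  Phi Omega y p e + t * (m.+1%:R^-1 - ar (p + t *: delta_mx j 0) e (lift ord0 j))
  <= Phi Omega y (p + t *: delta_mx j 0) e.
Proof.
have := Phi_upper (p + t *: delta_mx j 0) e (- t) j.
rewrite scaleNr addrK; move: (m.+1%:R^-1 - _) => q.
by rewrite mulNr -lerBlDr opprK.
Qed.

(** [Phi_upper] and [Phi_lower] enclose the increment between [t] times the same expression at the
    two ends, which differ by O(t) because the areas are Lipschitz. *)
Lemma grad_PhiE p e (j : 'I_m) :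
  grad_Phi Omega y p e j 0 = m.+1%:R^-1 - ar p e (lift ord0 j).
Proof.
rewrite mxE; apply: (@derive_quadratic_error _ _ _ _ _ _ unit_ar_lip) => t.
have h1 := Phi_upper p e t j; have h2 := Phi_lower p e t j.
have h3 := ar_shift_lip p e t j (lift ord0 j).
set a := ar p e _ in h1 h3 *; set b := ar _ e _ in h2 h3.
apply: (@le_trans _ _ (`|t| * `|b - a|)).
  rewrite -normrM; move: (m.+1%:R^-1) h1 h2 => iN h1 h2.
  have h4 := ler_norm (t * (b - a)); have h5 := normr_ge0 (t * (b - a)).
  by rewrite ler_norml; apply/andP; split; lra.
rewrite -[t ^+ 2]ger0_norm ?sqr_ge0 // normrX expr2 mulrCA.
by apply: ler_wpM2l.
Qed.

(** Each sign of [t] gives one inequality for the area at shifted prices; then [t] tends to 0. *)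
Lemma optimal_ar p e i : optimal_price Omega y e p -> ar p e i = m.+1%:R^-1.
Proof.
move=> opt.
have key (j : 'I_m) : ar p e (lift ord0 j) = m.+1%:R^-1.
  have step t : t * (m.+1%:R^-1 - ar (p + t *: delta_mx j 0) e (lift ord0 j)) <= 0.
    by have := le_trans (Phi_lower p e t j) (opt _); rewrite gerDl.
  have C0 := unit_ar_lip_ge0.
  apply/le_anti/andP; split; apply: (le_of_linear_error C0) => t t0.
  - have := step (- t); rewrite mulNr oppr_le0 pmulr_rge0 // subr_ge0 => h1.
    have := ar_shift_lip p e (- t) j (lift ord0 j).
    rewrite normrN (gtr0_norm t0) ler_distlC => /andP[_ h2].
    by apply: le_trans h2 _; rewrite lerD2r.
  - have := step t; rewrite pmulr_rle0 // subr_le0 => h1; apply: (le_trans h1).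
    have := ar_shift_lip p e t j (lift ord0 j).
    by rewrite (gtr0_norm t0) ler_distl => /andP[].
case: (unliftP ord0 i) => [j|] ->; first exact: key.
(* The first price is fixed and cannot be varied, so its cell is obtained from the total area. *)
have := sum_ar p e; rewrite big_ord_recl.
under eq_bigr do rewrite key.
rewrite sumr_const card_ord -mulr_natl -natr1 => h1.
have m0 : m%:R + 1 != 0 :> R by rewrite natr1 pnatr_eq0.
have -> : ar p e ord0 = 1 - m%:R * (m%:R + 1)^-1 by lra.
by field.
Qed.

Let oppr_gradB (x a b c : R) : - (x - a - (x - b) - - c) = a - b - c.
Proof. by ring. Qed.

Lemma hess_PhiE p e eta (i j : 'I_m) : 0 < eta -> (forall k, eta <= ar p e k) ->
  hess_Phi Omega y p e i j = - dar p e (delta_mx j 0) 0 (lift ord0 i).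
Proof.
move=> eta0 area_ge; rewrite mxE.
apply: (@derive_quadratic_error _ _ _ _ _ _ (taylor_const eta)) => t.
have h1 := ar_taylor eta0 area_ge (t *: delta_mx j 0) (t * 0) (lift ord0 i).
rewrite darZ mulr0 addr0 normr0 addr0 in h1.
rewrite 2!grad_PhiE -normrN mulrN oppr_gradB.
apply: (le_trans h1); apply: ler_wpM2l; first exact: taylor_const_ge0.
rewrite -[t ^+ 2]ger0_norm ?sqr_ge0 // normrX; apply: lerXn2r; rewrite ?nnegrE //.
rewrite normrZ -[leRHS]mulr1; apply: ler_wpM2l => //.
exact: norm_delta.
Qed.

Lemma deps_grad_PhiE p e eta (i : 'I_m) : 0 < eta -> (forall k, eta <= ar p e k) ->
  0 <= e <= 1 ->
  deps_grad_Phi Omega y p e i 0 = - dar p e 0 1 (lift ord0 i).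
Proof.
move=> eta0 area_ge e01; rewrite mxE.
apply: (@derive01_quadratic_error _ _ _ _ (taylor_const eta)) => // t _.
have h1 := ar_taylor eta0 area_ge ((t - e) *: 0) ((t - e) * 1) (lift ord0 i).
rewrite darZ scaler0 addr0 mulr1 normr0 add0r real_normK ?num_real // (addrC e) subrK in h1.
by rewrite 2!grad_PhiE -normrN mulrN oppr_gradB.
Qed.

Lemma dar_sum p e i (s : seq 'I_m) (z : 'cV[R]_m) :
  dar p e (\sum_(j <- s) z j 0 *: delta_mx j 0) 0 i =
  \sum_(j <- s) z j 0 * dar p e (delta_mx j 0) 0 i.
Proof.
elim: s => [|j s ih].
  by rewrite !big_nil -(scale0r (0 : 'cV[R]_m)) -[X in dar _ _ _ X](mul0r 0) darZ mul0r.
rewrite !big_cons -ih -[X in dar _ _ (_ + _) X](addr0 0) darD; congr (_ + _).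
by rewrite -[X in dar _ _ _ X](mulr0 (z j 0)) darZ.
Qed.

(** Turns the linear system of the algorithm into a statement about first variations of areas. *)
Lemma hess_mul p e eta z (i : 'I_m) : 0 < eta -> (forall k, eta <= ar p e k) ->
  (- hess_Phi Omega y p e *m z) i 0 = dar p e z 0 (lift ord0 i).
Proof.
move=> eta0 area_ge; rewrite mxE.
have {2}-> : z = \sum_j z j 0 *: delta_mx j 0.
  apply/matrixP => k l; rewrite (ord1 l) summxE (bigD1 k) //= big1 => [|j jk].
    by rewrite !mxE !eqxx mulr1 addr0.
  by rewrite !mxE eq_sym (negbTE jk) mulr0.
rewrite dar_sum; apply: eq_bigr => j _.
by rewrite mxE (hess_PhiE _ _ eta0 area_ge) opprK mulrC.
Qed.

(** * Convergence of the Euler scheme *)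

Section NewtonField.
Variables (p : 'cV[R]_m) (e eta : R).
Hypothesis eta_gt0 : 0 < eta.
Hypothesis area_ge : forall k, eta <= ar p e k.
Hypothesis e01 : 0 <= e <= 1.

(* The quadratic lower bound is inherited from [strong_monotone] along
   [p + t z] as [t] goes to [0]. *)
Lemma dar_coercive z :
  mono_const eta * `|z| ^+ 2 <= \sum_k price z k * dar p e z 0 k.
Proof.
set Q := \sum_k _; rewrite leNgt; apply/negP => lt.
pose K := m.+1%:R * (taylor_const eta * `|z| ^+ 3).
have K0 : 0 <= K by rewrite mulr_ge0 // mulr_ge0 ?exprn_ge0 // taylor_const_ge0.
pose d := mono_const eta * `|z| ^+ 2 - Q; have d0 : 0 < d by rewrite subr_gt0.
(* The first entry keeps the norm of [t *: z] at most 1, where [strong_monotone] is quadratic; the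
   second makes the cubic remainder smaller than the deficit [d]. *)
pose t := Num.min (1 + `|z|)^-1 (d / (2 * (K + 1))).
have z1 : 0 < 1 + `|z| by have := normr_ge0 z; lra.
have K1 : 0 < 2 * (K + 1) by lra.
have t0 : 0 < t by rewrite lt_min invr_gt0 z1 divr_gt0.
have tz : t * `|z| <= 1.
  apply: (@le_trans _ _ ((1 + `|z|)^-1 * `|z|)).
    by rewrite ler_wpM2r // ge_min lexx.
  by rewrite mulrC ler_pdivrMr //; lra.
have tK : t * K < d.
  have : t * (2 * (K + 1)) <= d by rewrite -ler_pdivlMr // ge_min lexx orbT.
  lra.
have ntz : `|t *: z| = t * `|z| by rewrite normrZ gtr0_norm.
have h1 := strong_monotone (t *: z) eta_gt0 area_ge e01.
rewrite ntz min_r // in h1.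
have h2 : \sum_k price (t *: z) k * (ar (p + t *: z) e k - ar p e k) <=
    t ^+ 2 * Q + t ^+ 3 * K.
  have -> : t ^+ 2 * Q + t ^+ 3 * K =
      \sum_(k < m.+1) (t ^+ 2 * (price z k * dar p e z 0 k) +
        t ^+ 3 * (taylor_const eta * `|z| ^+ 3)).
    rewrite big_split /= -mulr_sumr sumr_const card_ord -/Q; congr (_ + _).
    by rewrite /K -mulr_natl; ring.
  apply: ler_sum => k _; rewrite priceZ.
  have := ar_taylor eta_gt0 area_ge (t *: z) 0 k.
  rewrite normr0 !addr0 ntz -[X in dar _ _ _ X](mulr0 t) darZ => h3.
  set a := ar _ e k - ar p e k in h3 *; set b := dar _ _ _ _ _ in h3 *.
  have pz : `|price z k| <= `|z| := price_norm z k.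
  have : `|t * price z k * (a - t * b)| <=
      t * `|z| * (taylor_const eta * (t * `|z|) ^+ 2).
    rewrite normrM; apply: ler_pM => //.
    by rewrite normrM gtr0_norm // ler_wpM2l // ltW.
  move=> h4; have h5 := le_trans (ler_norm _) h4.
  rewrite -subr_ge0 in h5; rewrite -subr_ge0.
  by apply: le_trans h5 _; rewrite le_eqVlt; apply/orP; left; apply/eqP; ring.
have h3 := le_trans h1 h2.
have : t ^+ 2 * d <= t ^+ 2 * (t * K).
  rewrite -subr_ge0; rewrite -subr_ge0 in h3.
  by apply: le_trans h3 _; rewrite /d le_eqVlt; apply/orP; left; apply/eqP; ring.
rewrite ler_pM2l ?exprn_gt0 // => h4; lra.
Qed.

(** In [dar_coercive] the first price is 0, so its cell drops out; dividing by the norm of [z] gives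
    this. *)
Lemma dar_lower z :
  mono_const eta * `|z| <= \sum_(j < m) `|dar p e z 0 (lift ord0 j)|.
Proof.
have [->|z0] := eqVneq z 0.
  by rewrite normr0 mulr0; apply: sumr_ge0.
have nz : 0 < `|z| by rewrite normr_gt0.
rewrite -(ler_pM2r nz) -mulrA -expr2; apply: (le_trans (dar_coercive z)).
rewrite big_ord_recl price_ord0 mul0r add0r mulr_suml; apply: ler_sum => j _.
apply: le_trans (ler_norm _) _; rewrite normrM mulrC.
by apply: ler_wpM2l => //; apply: price_norm.
Qed.

Lemma hess_unit : - hess_Phi Omega y p e \in unitmx.
Proof.
(* [kermx] is a left kernel, hence the transpose; a kernel vector then vanishes by [dar_lower]. *)
rewrite -unitmx_tr -row_free_unit -kermx_eq0; apply/eqP/row_matrixP => i.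
rewrite row0; set r := row i _.
have r0 : - hess_Phi Omega y p e *m r^T = 0.
  rewrite -[LHS]trmxK trmx_mul trmxK.
  by rewrite (_ : r *m _ = 0) ?trmx0 // /r -row_mul mulmx_ker row0.
have : r^T = 0.
  apply/eqP; rewrite -normr_le0 -(pmulr_rle0 _ (mono_const_gt0 eta_gt0)).
  apply: (le_trans (dar_lower _)); rewrite big1 // => j _.
  by rewrite -(hess_mul _ _ eta_gt0 area_ge) r0 mxE normr0.
by move=> /(congr1 trmx); rewrite trmxK trmx0.
Qed.

Definition euler_dir : 'cV[R]_m :=
  invmx (- hess_Phi Omega y p e) *m deps_grad_Phi Omega y p e.

(** The purpose of the linear system: along [(euler_dir, 1)] the areas are stationary to first
    order. *)
Lemma dar_euler_dir (j : 'I_m) : dar p e euler_dir 1 (lift ord0 j) = 0.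
Proof.
rewrite -[euler_dir]addr0 -[X in dar _ _ _ X]add0r darD.
rewrite -(hess_mul _ _ eta_gt0 area_ge) mulKVmx ?hess_unit //.
by rewrite (deps_grad_PhiE _ eta_gt0 area_ge e01) addNr.
Qed.

Lemma euler_dir_bound : `|euler_dir| <= m%:R * dar_lip / mono_const eta.
Proof.
rewrite ler_pdivlMr ?mono_const_gt0 // mulrC; apply: (le_trans (dar_lower _)).
have -> : m%:R * dar_lip = \sum_(j < m) dar_lip.
  by rewrite sumr_const card_ord mulr_natl.
apply: ler_sum => j _.
rewrite -(hess_mul _ _ eta_gt0 area_ge) mulKVmx ?hess_unit //.
rewrite (deps_grad_PhiE _ eta_gt0 area_ge e01) normrN.
by have := dar_bound p e 0 1 (lift ord0 j); rewrite normr0 normr1 add0r mulr1.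
Qed.

End NewtonField.

(** The estimates use the maximum norm, the theorem the Euclidean one; a crude factor suffices. *)
Lemma enorm_le (v : 'cV[R]_m) : enorm v <= m.+1%:R * `|v|.
Proof.
have N0 : 0 <= m.+1%:R * `|v| by rewrite mulr_ge0.
rewrite /enorm -[leRHS]ger0_norm // -sqrtr_sqr ler_sqrt ?sqr_ge0 //.
apply: (@le_trans _ _ (\sum_(i < m) `|v| ^+ 2)).
  apply: ler_sum => i _; rewrite -[v i 0 ^+ 2]ger0_norm ?sqr_ge0 // normrX.
  by rewrite lerXn2r ?nnegrE // -price_lift price_norm.
rewrite sumr_const card_ord -[_ *+ m]mulr_natl exprMn ler_wpM2r ?sqr_ge0 //.
rewrite -natrX ler_nat; apply: leq_trans (leqnSn m) _.
by rewrite expnS expn1 leq_pmulr.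
Qed.

Variable popt : R -> 'cV[R]_m.
Hypothesis popt_optimal :
  forall e : R, 0 <= e <= 1 -> optimal_price Omega y e (popt e).

Let N : R := m.+1%:R.
(** The lower area bound of [in_O], half of the optimal area. *)
Let eta : R := (2 * N)^-1.

Let N_ge1 : 1 <= N.
Proof. by rewrite ler1n. Qed.

Let eta_gt0 : 0 < eta.
Proof. by have := N_ge1 => ?; rewrite invr_gt0; lra. Qed.

(** The Taylor remainder of one step divided by the square of the step size; the base of the square
    bounds the size of the direction, with 1 for the time component. *)
Definition step_const : R :=
  taylor_const eta * (m%:R * dar_lip / mono_const eta + 1) ^+ 2.

(** The first term is the drift of the areas while [e] runs through a step with frozen prices, the
    second the error accumulated by the scheme. *)
Definition area_err_const : R := 4 * D * tie_lip + N * step_const.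

(** The first entry keeps the area errors below [eta]; the second excludes price errors of norm at
    least 1 in [euler_error]. *)
Definition step_bound : R := Num.min (4 * N ^+ 2 * (step_const + 1))^-1
  (mono_const eta / (2 * (N * area_err_const + 1))).

Lemma step_const_ge0 : 0 <= step_const.
Proof. by rewrite mulr_ge0 ?sqr_ge0 // taylor_const_ge0. Qed.

Lemma area_err_const_ge0 : 0 <= area_err_const.
Proof.
apply: addr_ge0; first exact: unit_ar_lip_ge0.
by apply: mulr_ge0; [have := N_ge1; lra|exact: step_const_ge0].
Qed.

Lemma step_bound_gt0 : 0 < step_bound.
Proof.
have s0 := step_const_ge0; have a0 := area_err_const_ge0; have N1 := N_ge1.
rewrite lt_min; apply/andP; split.
  by rewrite invr_gt0 mulr_gt0 ?mulr_gt0 ?exprn_gt0 //; lra.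
apply: divr_gt0; first exact: mono_const_gt0.
by have : 0 <= N * area_err_const by [apply: mulr_ge0 => //; lra]; lra.
Qed.

Lemma optimal_area e i : 0 <= e <= 1 -> ar (popt e) e i = N^-1.
Proof. by move=> e01; apply: optimal_ar; exact: popt_optimal. Qed.

(* The areas sum to 1, so the errors of the cells other than the first control
   that of the first. *)
Lemma area_err_all p e r : 0 <= r ->
  (forall j : 'I_m, `|ar p e (lift ord0 j) - N^-1| <= r) ->
  forall i, `|ar p e i - N^-1| <= N * r.
Proof.
move=> r0 hj i; have N1 := N_ge1.
case: (unliftP ord0 i) => [j|] ->.
  by apply: (le_trans (hj j)); rewrite ler_peMl.
have Es : ar p e ord0 - N^-1 = - \sum_(j < m) (ar p e (lift ord0 j) - N^-1).
  rewrite sumrB sumr_const card_ord -[_ *+ m]mulr_natl.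
  have E1 := sum_ar p e; rewrite big_ord_recl in E1.
  have E2 : m%:R * N^-1 + N^-1 = 1.
    by rewrite -[X in _ + X]mul1r -mulrDl natr1 divff // pnatr_eq0.
  by move: (m%:R * N^-1) (N^-1) E2 => a b E2; lra.
rewrite Es normrN; apply: (le_trans (ler_norm_sum _ _ _)).
apply: (@le_trans _ _ (\sum_(j < m) r)); first exact: ler_sum.
by rewrite sumr_const card_ord -[_ *+ m]mulr_natl ler_wpM2r // /N ler_nat.
Qed.

Section Steps.
Variable n : nat.
Hypothesis n_gt0 : (0 < n)%N.
Let hh : R := n%:R^-1.
Hypothesis h_small : hh <= step_bound.

Let hh_gt0 : 0 < hh.
Proof. by rewrite invr_gt0 ltr0n. Qed.

Let iter (k : nat) := euler Omega y (popt 0) n k.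

Lemma err_small r : 0 <= r -> r <= step_const * hh -> N * r < eta.
Proof.
move=> r0 hr; have s0 := step_const_ge0; have N1 := N_ge1.
have hb : hh <= (4 * N ^+ 2 * (step_const + 1))^-1.
  by apply: (le_trans h_small); rewrite ge_min lexx.
have P0 : 0 < 4 * N ^+ 2 * (step_const + 1).
  by rewrite mulr_gt0 ?mulr_gt0 ?exprn_gt0 //; lra.
have : hh * (4 * N ^+ 2 * (step_const + 1)) <= 1.
  by rewrite -ler_pdivlMr // mul1r.
have h0 := hh_gt0 => h1.
rewrite /eta -[ltRHS]mul1r ltr_pdivlMr; last lra.
have N2 : 0 < N ^+ 2 by rewrite exprn_gt0 //; lra.
have h2 : N ^+ 2 * r <= N ^+ 2 * (step_const * hh).
  by apply: ler_wpM2l => //; exact: ltW.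
have h3 : 0 < N ^+ 2 * hh by rewrite mulr_gt0.
have -> : N * r * (2 * N) = 2 * (N ^+ 2 * r) by ring.
by move: (N ^+ 2) h1 h2 h3 => M h1 h2 h3; lra.
Qed.

Let N_inv : N^-1 = 2 * eta.
Proof.
have N1 := N_ge1; have N0 : N != 0 by rewrite gt_eqF //; lra.
by rewrite /eta; field.
Qed.

Lemma time_in (k : nat) : (k <= n)%N -> 0 <= k%:R * hh <= 1.
Proof.
move=> kn; rewrite mulr_ge0 ?(ltW hh_gt0) //=.
by rewrite ler_pdivrMr ?ltr0n // mul1r ler_nat.
Qed.

Lemma total_err (k : nat) : (k <= n)%N ->
  k%:R * (step_const * hh ^+ 2) <= step_const * hh.
Proof.
move=> kn; rewrite expr2 (_ : _ * _ = step_const * hh * (k%:R * hh)); last by ring.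
rewrite -[leRHS]mulr1; apply: ler_wpM2l.
  by apply: mulr_ge0; [exact: step_const_ge0|exact: ltW].
by case/andP: (time_in kn).
Qed.

Lemma area_ge_of_err p e r : 0 <= r -> r <= step_const * hh ->
  (forall j : 'I_m, `|ar p e (lift ord0 j) - N^-1| <= r) ->
  forall i, eta <= ar p e i.
Proof.
move=> r0 rs IH i; have := area_err_all r0 IH i; have := err_small r0 rs.
by rewrite ler_norml N_inv => h1 /andP[h2 _]; lra.
Qed.

(** By induction: the bound reached so far keeps all areas above [eta], so the Taylor expansion
    applies at the current iterate, and its linear part vanishes by [dar_euler_dir]. *)
Lemma euler_area_err (k : nat) : (k <= n)%N -> forall j : 'I_m,
  `|ar (iter k) (k%:R * hh) (lift ord0 j) - N^-1| <= k%:R * (step_const * hh ^+ 2).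
Proof.
have s0 := step_const_ge0; have h0 := hh_gt0.
elim: k => [|k IH] kn j.
  by rewrite !mul0r optimal_area ?lexx ?ler01 // subrr normr0.
have {}IH := IH (ltnW kn).
have kh01 := time_in (ltnW kn).
have r0 : 0 <= k%:R * (step_const * hh ^+ 2).
  by rewrite mulr_ge0 // mulr_ge0 // sqr_ge0.
have rs := total_err (ltnW kn).
have area_ge := area_ge_of_err r0 rs IH.
have Estep : iter k.+1 = iter k + hh *: euler_dir (iter k) (k%:R * hh) by [].
have zb := euler_dir_bound eta_gt0 area_ge kh01.
have dz := dar_euler_dir eta_gt0 area_ge kh01 j.
rewrite Estep; set z := euler_dir _ _ in zb dz *.
have -> : k.+1%:R * hh = k%:R * hh + hh by rewrite -natr1 mulrDl mul1r.
have := ar_taylor eta_gt0 area_ge (hh *: z) hh (lift ord0 j).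
have -> : dar (iter k) (k%:R * hh) (hh *: z) hh (lift ord0 j) = 0.
  by rewrite -[X in dar _ _ _ X](mulr1 hh) darZ dz mulr0.
rewrite subr0 normrZ gtr0_norm // => h1.
have h2 : taylor_const eta * (hh * `|z| + hh) ^+ 2 <= step_const * hh ^+ 2.
  rewrite /step_const -mulrA; apply: ler_wpM2l; first exact: taylor_const_ge0.
  rewrite -exprMn; apply: lerXn2r.
  - by rewrite nnegrE addr_ge0 ?mulr_ge0 // ltW.
  - rewrite nnegrE mulr_ge0 ?(ltW h0) //; have := normr_ge0 z; lra.
  - by rewrite -[X in _ * _ + X]mulr1 -mulrDr mulrC ler_wpM2r ?(ltW h0) // lerD2r.
have {}IH := IH j.
rewrite -natr1 mulrDl mul1r [leRHS]addrC; set a := ar _ (_ + hh) _ in h1 *.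
apply: le_trans (ler_distD (ar (iter k) (k%:R * hh) (lift ord0 j)) _ _) _.
apply: lerD => //.
exact: le_trans h1 h2.
Qed.

Lemma euler_area_err_all (k : nat) : (k <= n)%N -> forall i,
  `|ar (iter k) (k%:R * hh) i - N^-1| <= N * (step_const * hh).
Proof.
move=> kn; have s0 := step_const_ge0; have h0 := hh_gt0.
apply: area_err_all; first by rewrite mulr_ge0 // ltW.
by move=> j; apply: (le_trans (euler_area_err kn j)); exact: total_err.
Qed.

(** Since [N^-1 = 2 * eta], an error below [eta] keeps every area between [eta] and [3 * eta], and
    the upper bound of [in_O] is [4 * eta]. *)
Lemma euler_in_O (k : nat) : (k < n)%N -> in_O Omega y (iter k) (k%:R * hh).
Proof.
move=> kn; split; first exact: time_in (ltnW kn).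
move=> i; rewrite areaE !lte_fin -/N.
have := euler_area_err_all (ltnW kn) i.
have s0 := step_const_ge0; have h0 := ltW hh_gt0.
have := err_small (mulr_ge0 s0 h0) (lexx _); have e0 := eta_gt0.
rewrite ler_norml N_inv -/eta => h1 /andP[h2 h3].
by apply/andP; split; lra.
Qed.

(** At time [e] both price vectors give areas within O(h) of each other, and strong monotonicity at
    [popt e] converts this into a bound on the prices. *)
Lemma euler_error (e : R) : 0 <= e <= 1 ->
  enorm (euler_fun Omega y (popt 0) n e - popt e) <=
  N * (N * area_err_const / mono_const eta) * hh.
Proof.
move=> e01; have /andP[e0 e1] := e01; have h0 := hh_gt0; have N1 := N_ge1.
have n0 : 0 < n%:R :> R by rewrite ltr0n.
have s0 := step_const_ge0; have a0 := area_err_const_ge0.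
have c0 := mono_const_gt0 eta_gt0.
have en0 : 0 <= e * n%:R by rewrite mulr_ge0.
rewrite /euler_fun; set k := Num.truncn (e * n%:R).
have /andP[k1 k2] := truncn_itv en0; rewrite -/k in k1 k2.
(* The value [k = n] occurs at [e = 1]; the area estimate includes the last iterate. *)
have kn : (k <= n)%N.
  by rewrite -(ler_nat R); apply: (le_trans k1); rewrite ler_piMl // ltW.
have ke : `|e - k%:R * hh| <= hh.
  have E : (e * n%:R) * hh = e by rewrite mulfK // gt_eqF.
  have : k%:R * hh <= (e * n%:R) * hh by rewrite ler_wpM2r // ltW.
  have : (e * n%:R) * hh <= k.+1%:R * hh by rewrite ler_wpM2r // ltW.
  rewrite E -natr1 mulrDl mul1r => ? ?.
  by rewrite ger0_norm; lra.
rewrite -/(iter k); set w := iter k - popt e.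
have Ek : iter k = popt e + w by rewrite /w addrC subrK.
have err i : `|ar (iter k) e i - N^-1| <= area_err_const * hh.
  have h1 := euler_area_err_all kn i.
  have h2 := ar_lip (iter k) 0 (k%:R * hh) (e - k%:R * hh) i.
  rewrite addr0 (addrC (k%:R * hh)) subrK normr0 add0r in h2.
  have h3 : 4 * D * tie_lip * `|e - k%:R * hh| <= 4 * D * tie_lip * hh.
    by apply: ler_wpM2l => //; exact: unit_ar_lip_ge0.
  rewrite /area_err_const mulrDl.
  apply: le_trans (ler_distD (ar (iter k) (k%:R * hh) i) _ _) _.
  by apply: lerD; [exact: le_trans h2 h3|rewrite -mulrA].
have area_ge i : eta <= ar (popt e) e i.
  by rewrite optimal_area // N_inv; have := eta_gt0; lra.
have h1 := strong_monotone w eta_gt0 area_ge e01.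
rewrite -Ek in h1.
have h2 : \sum_i price w i * (ar (iter k) e i - ar (popt e) e i) <=
    `|w| * (N * area_err_const * hh).
  rewrite (_ : _ * (_ * hh) = \sum_(i < m.+1) `|w| * (area_err_const * hh)); last first.
    by rewrite sumr_const card_ord -[_ *+ m.+1]mulr_natl -/N; ring.
  apply: ler_sum => i _; rewrite optimal_area //.
  apply: le_trans (ler_norm _) _; rewrite normrM; apply: ler_pM => //.
  exact: price_norm.
have h3 := le_trans h1 h2.
have hb : N * area_err_const * hh < mono_const eta.
  have hs : hh <= mono_const eta / (2 * (N * area_err_const + 1)).
    by apply: (le_trans h_small); rewrite ge_min lexx orbT.
  have Na : 0 <= N * area_err_const by apply: mulr_ge0 => //; lra.
  have : hh * (2 * (N * area_err_const + 1)) <= mono_const eta.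
    by rewrite -ler_pdivlMr //; lra.
  have : 0 <= N * area_err_const * hh by rewrite mulr_ge0 // ltW.
  lra.
have wb : `|w| <= N * area_err_const / mono_const eta * hh.
  have [->|w0] := eqVneq w 0.
    rewrite normr0; apply: mulr_ge0; last exact: ltW.
    by apply: divr_ge0; [apply: mulr_ge0 => //; lra|exact: ltW].
  have nw : 0 < `|w| by rewrite normr_gt0.
  have h4 : mono_const eta * Num.min 1 `|w| <= N * area_err_const * hh.
    rewrite -(ler_pM2l nw); apply: le_trans h3.
    by rewrite le_eqVlt; apply/orP; left; apply/eqP; ring.
  rewrite mulrAC ler_pdivlMr // mulrC.
  (* If the norm of [w] were at least 1, [h4] would contradict [hb]. *)
  by move: h4; case: (leP 1 `|w|) => // _; rewrite mulr1; lra.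
apply: (le_trans (enorm_le w)); rewrite -mulrA.
by apply: ler_wpM2l => //; lra.
Qed.

End Steps.

Theorem euler_convergence : exists h0 K : R, 0 < h0 /\
  forall n : nat, (0 < n)%N -> n%:R^-1 <= h0 ->
    (forall k : nat, (k < n)%N ->
       in_O Omega y (euler Omega y (popt 0) n k) (k%:R * n%:R^-1)) /\
    (forall e : R, 0 <= e <= 1 ->
       enorm (euler_fun Omega y (popt 0) n e - popt e) <= K * n%:R^-1).
Proof.
exists step_bound, (N * (N * area_err_const / mono_const eta)).
split; first exact: step_bound_gt0.
move=> n n0 hn; split=> [k kn|e e01]; first exact: euler_in_O.
exact: euler_error.
Qed.

End CellGeometry.

Theorem theorem4p1 (R : realType) (m : nat) (Omega : set (R * R))
    (y : 'I_m.+1 -> R * R) (popt : R -> 'cV[R]_m)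
    (Omega_polygon : convex_polygon Omega)
    (Omega_area : area Omega = 1%E)
    (y_Omega : forall i, Omega (y i))
    (y_distinct : forall i j, i != j -> (y i).2 != (y j).2)
    (popt_optimal : forall e : R, 0 <= e <= 1 ->
       optimal_price Omega y e (popt e)) :
  exists h0 K : R, 0 < h0 /\
    forall n : nat, (0 < n)%N -> n%:R^-1 <= h0 ->
      (forall k : nat, (k < n)%N ->
         in_O Omega y (euler Omega y (popt 0) n k) (k%:R * n%:R^-1)) /\
      (forall e : R, 0 <= e <= 1 ->
         enorm (euler_fun Omega y (popt 0) n e - popt e) <= K * n%:R^-1).
Proof.
have [J [g [h [D [iJ cg ch OmegaE [D0 bound]]]]]] := polygon_graph Omega_polygon.
have JD x : J x -> - D <= x <= D by case/bound.
have gD x : J x -> g x <= D by case/bound.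
have hD x : J x -> h x <= D by case/bound.
(* The points lie in the polygon, so its bound [D] serves for them too. *)
have yD i : `|(y i).1| <= D /\ `|(y i).2| <= D.
  have := y_Omega i; rewrite OmegaE /= !ler_norml => -[Jy /andP[hy gy]].
  have := gD _ Jy; have := hD _ Jy => ? ?.
  by split; [exact: JD|apply/andP; split; lra].
exact: (euler_convergence iJ cg ch OmegaE y_distinct D0 JD gD hD yD Omega_area
  popt_optimal).
Qed.
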